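(* We have \begin{align*} \sum_{i,j,k\geq 0} \frac{q^{2i^2+3j^2+4k^2-4ij-4ik+4jk-2i+4k}}{(q^4;q^4)_i(q^4;q^4)_j(q^4;q^4)_k}&=2q^{-1}\frac{J_2^5J_8^2}{J_1^2J_4^5}, \\ \sum_{i,j,k\geq 0} \frac{q^{2i^2+3j^2+4k^2-4ij-4ik+4jk-j+2k}}{(q^4;q^4)_i(q^4;q^4)_j(q^4;q^4)_k}&=2\frac{J_4^2}{J_2^2}, \\ \sum_{i,j,k\geq 0} \frac{q^{2i^2+3j^2+4k^2-4ij-4ik+4jk-2i+2j+4k}}{(q^4;q^4)_i(q^4;q^4)_j(q^4;q^4)_k}&=2\frac{J_2^2J_3J_{24}^4}{J_1J_4^2J_6J_{12}J_{4,24}^2}, \\ \sum_{i,j,k\geq 0} \frac{q^{2i^2+3j^2+4k^2-4ij-4ik+4jk+2i}}{(q^4;q^4)_i(q^4;q^4)_j(q^4;q^4)_k}&=\frac{J_6^2J_{6,24}^3J_{24}}{J_3^2J_4J_{12}J_{4,24}^2}, \\ \sum_{i,j,k\geq 0} \frac{q^{2i^2+3j^2+4k^2-4ij-4ik+4jk}}{(q^4;q^4)_i(q^4;q^4)_j(q^4;q^4)_k}&=\frac{J_{12}^3J_{4,24}^2J_{5,24}J_{7,24}}{J_1J_{24}^6}, \\ \sum_{i,j,k\geq 0} \frac{q^{2i^2+3j^2+4k^2-4ij-4ik+4jk+2j+4k}}{(q^4;q^4)_i(q^4;q^4)_j(q^4;q^4)_k}&=\frac{J_{12}^3J_{1,24}J_{11,24}J_{4,24}^2}{J_1J_{24}^6},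 \\ \sum_{i,j,k\geq 0} \frac{q^{2i^2+3j^2+4k^2-4ij-4ik+4jk+2i-2j}}{(q^4;q^4)_i(q^4;q^4)_j(q^4;q^4)_k}&=\frac{J_2^5J_8^2}{J_1^2J_4^5}. \end{align*}
   Context: Throughout $0<|q|<1$. Notation: $(a;q)_n=\prod_{k=0}^{n-1}(1-aq^k)$, $(a;q)_\infty=\prod_{k\ge0}(1-aq^k)$, $(a_1,\dots,a_r;q)_\infty=\prod_s(a_s;q)_\infty$; $J_m:=(q^m;q^m)_\infty$ and $J_{a,m}:=(q^a,q^{m-a},q^m;q^m)_\infty$. *)

(* Defs.v *)
From mathcomp Require Export all_boot all_order all_algebra.
From mathcomp Require Export finmap complex.
From mathcomp Require Export all_classical all_reals topology normedtype sequences.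
From mathcomp Require Export summability.

Set Implicit Arguments.
Unset Strict Implicit.
Unset Printing Implicit Defensive.

Export Order.TTheory GRing.Theory Num.Theory.
Export numFieldNormedType.Exports.

Open Scope classical_set_scope.
Open Scope ring_scope.
Open Scope complex_scope.

Section QSeries.
(* Generic in [C], so that the topology is the canonical one of a
   [numFieldType]; used at [C := R[i]] with [R : realType]. *)
Variable C : numFieldType.
Implicit Types (a q : C) (m n : nat).

Definition qpoch a q n : C := \prod_(k < n) (1 - a * q ^+ k).

Definition qpoch_inf a q : C := lim (qpoch a q n @[n --> \oo]).

Definition qpochs_inf (s : seq C) q : C := \prod_(a <- s) qpoch_inf a q.

Definition qJ q m : C := qpoch_inf (q ^+ m) (q ^+ m).

(* The subtraction [m - a] is truncated: only meant for [a <= m]. *)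
Definition qJp q (a m : nat) : C :=
  qpochs_inf [:: q ^+ a; q ^+ (m - a); q ^+ m] (q ^+ m).

Definition quad_exp (i j k : nat) : int :=
  2 * i%:Z ^+ 2 + 3 * j%:Z ^+ 2 + 4 * k%:Z ^+ 2
  - 4 * i%:Z * j%:Z - 4 * i%:Z * k%:Z + 4 * j%:Z * k%:Z.

(* The linear part of the exponent is [b1 * i + b2 * j + b3 * k]; the whole
   exponent may be negative, hence the integer power of [q]. *)
Definition nahm_term q (b1 b2 b3 : int) (t : nat * nat * nat) : C :=
  let: (i, j, k) := t in
  q ^ (quad_exp i j k + b1 * i%:Z + b2 * j%:Z + b3 * k%:Z)
  / (qpoch (q ^+ 4) (q ^+ 4) i * qpoch (q ^+ 4) (q ^+ 4) j
     * qpoch (q ^+ 4) (q ^+ 4) k).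

(* Unconditional convergence: the net of sums over finite sets of triples,
   directed by inclusion, converges to [l]. For [C := R[i]] this is the same as
   absolute convergence of the triple series with sum [l]. *)
Definition nahm_sum_is q (b1 b2 b3 : int) (l : C) : Prop :=
  partial_sum (nahm_term q b1 b2 b3) @ totally --> l.

End QSeries.

(* Main.v *)
(* Put [p = q^4]. The exponent is [2 (i - j - k)^2 + j^2 + 2 k^2 + b1 i + b2 j + b3 k].
   Expanding [1 / ((p)_i (p)_k)] by the Durfee rectangle identity turns the
   triple sum into a fourfold one, in which two of the indices are summed by
   Euler's theorem; what is left is [P * \sum_n q^(n^2) w_n] with two infinite
   products [P] and
     [w_n = \sum_(j + 2 k = n) q^((b1 + b2) j + b3 k) (- q^(2 - b1); p)_j
              / ((p)_j (p)_k (- q^(2 + b1 + b3); p)_k)].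
   In all seven cases [w_n = \sum_(a + b = n) c_(a - b) / ((p)_a (p)_b) ] for a
   simple Laurent monomial [c_d] in [q] (up to a shift of [n] and the average of
   two such sums), because the generating functions of both sides satisfy the
   same first order [q]-difference equation. Summing over [a] and [b] with
   [d = a - b] fixed gives [1 / (p)_inf] once more by Durfee rectangles, so the
   Nahm sum equals [P / (p)_inf * \sum_d c_d q^(d^2)], and the Jacobi triple
   product evaluates this theta series. For (b1, b2, b3) = (0, 0, 0) and
   (0, 2, 4) the theta series are the half sum and half difference of
   [phi(q) = \sum_d q^(d^2)] and [phi(q^3)]; these are products since
   [f(q, -q^2)] and [f(-q, q^2)] are the sum and difference of [J_(5,12)] and
   [q J_(1,12)]. *)

Require Import Defs.
From mathcomp Require Import ring zify.

Set Implicit Arguments.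
Unset Strict Implicit.
Unset Printing Implicit Defensive.

#[local] Existing Instance totally_filter.

(** * Unconditional summation *)

(** Summing over i at once would leave the exponent j^2 + 2 k^2 and a symbol of index j + k. After
    the rectangle identity the exponent is (j + 2 k)^2, a function of n = j + 2 k alone, so w_n is a
    convolution with generating function f(x) g(x^2), where f(x) = (- q^(2 + b2) x; p)_inf / (q^(b1
    + b2) x; p)_inf. The shape of g separates the cases. In five of them 2 + b1 + b3 = 4, so (p)_k
    (- p; p)_k = (p^2; p^2)_k and g(x^2) = 1 / (q^b3 x^2; p^2)_inf. In the other two t = - q^2, a
    square root of p, takes over: (p)_k (t; p)_k = (t; t)_(2 k), so g(x^2) is the even part of 1 /
    (x; t)_inf for (0, 0, 0), and its odd part appears for (0, 2, 4) after a shift of n. Even and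
    odd parts are the source of the averages. Besides the Euler and Durfee series, only two families
    need a convergence estimate: the fourfold one and the one indexed by (a, b). All else passes
    from a convergent family to its fibre sums and identifies limits by uniqueness. *)

Section UnconditionalSums.
Variable C : numFieldType.

(* A one-constructor wrapper, so that unification does not unfold the limit. *)
Variant has_sum (T : choiceType) (f : T -> C) (l : C) : Prop :=
  HasSum of partial_sum f @ totally --> l.

Definition abs_summable (T : choiceType) (f : T -> C) : Prop :=
  exists M : C, forall A : {fset T}, \sum_(i <- A) `|f i| <= M.

Lemma partial_sumE (T : choiceType) (f : T -> C) (A : {fset T}) :
  partial_sum f A = \sum_(i <- A) f i.
Proof. by rewrite /partial_sum big_seq_fsetE. Qed.

Lemma has_sumP (T : choiceType) (f : T -> C) (l : C) :
  has_sum f l <-> forall e : C, 0 < e -> exists A : {fset T},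
    forall B : {fset T}, (A `<=` B)%fset -> `|l - \sum_(i <- B) f i| < e.
Proof.
split=> [[/cvgrPdist_lt h] e e0|h].
  have [A _ hA] := h e e0.
  by exists A => B AB; rewrite -partial_sumE; apply: hA.
split; apply/cvgrPdist_lt => e e0; have [A hA] := h e e0.
by exists A => // B AB /=; rewrite partial_sumE; apply: hA.
Qed.

Lemma has_sum_unique (T : choiceType) (f : T -> C) (l m : C) :
  has_sum f l -> has_sum f m -> l = m.
Proof. by move=> [h1] [h2]; apply: cvg_unique h1 h2; exact: norm_hausdorff. Qed.

Lemma has_sumZ (T : choiceType) (f : T -> C) (l c : C) :
  has_sum f l -> has_sum (fun t => c * f t) (c * l).
Proof.
case=> h; split.
have -> : partial_sum (fun t => c * f t) = (fun A => c * partial_sum f A).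
  by apply/funext => A; rewrite /partial_sum mulr_sumr.
by apply: cvgM => //; exact: cvg_cst.
Qed.

Lemma has_sumD (T : choiceType) (f g : T -> C) (l m : C) :
  has_sum f l -> has_sum g m -> has_sum (fun t => f t + g t) (l + m).
Proof.
case=> hf [hg]; split.
have -> : partial_sum (fun t => f t + g t) = partial_sum f \+ partial_sum g.
  by apply/funext => A; rewrite /partial_sum big_split.
exact: cvgD.
Qed.

Lemma eq_has_sum (T : choiceType) (f g : T -> C) (l : C) :
  f =1 g -> has_sum f l -> has_sum g l.
Proof. by move=> /funext ->. Qed.

Lemma has_sum_fset (T : choiceType) (f : T -> C) (A : {fset T}) :
  (forall t, t \notin A -> f t = 0) -> has_sum f (\sum_(t <- A) f t).
Proof.
move=> f0; apply/has_sumP => e e0; exists A => B AB.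
rewrite [X in _ - X](big_fsetID _ (mem A)) /= [X in _ - (_ + X)]big1_fset => [|t].
  rewrite addr0 (_ : [fset x in B | x \in A]%fset = A) ?subrr ?normr0 //.
  apply/fsetP => t; rewrite !inE /=; case: (boolP (t \in A)) => tA; rewrite ?andbF //.
  by rewrite (fsubsetP AB).
by rewrite !inE => /andP[_ /f0].
Qed.

(** Fubini with the sum of the whole family given: only the finitely many fibres over [B] matter at
    a time, and they share half of the error. No absolute convergence is assumed; the other
    rearrangements rest on this one. *)
Lemma has_sum_fibre (T I : choiceType) (phi : T -> I) (f : T -> C)
    (g : I -> C) (l : C) :
  has_sum f l ->
  (forall i, has_sum (fun t => if phi t == i then f t else 0) (g i)) ->
  has_sum g l.
Proof.
move=> /has_sumP hf hg; apply/has_sumP => e e0.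
have e20 : 0 < e / 2 by rewrite divr_gt0.
have [A hA] := hf _ e20; exists (phi @` A)%fset => B AB.
(* The [+ 1] covers an empty [B]. *)
have d0 : 0 < e / 2 / (#|` B|%:R + 1).
  by rewrite divr_gt0 // ltr_wpDl.
have {hg} hg i : {U : {fset T} | forall V : {fset T}, (U `<=` V)%fset ->
    `|g i - \sum_(t <- V | phi t == i) f t| < e / 2 / (#|` B|%:R + 1)}.
  apply: cid; have /has_sumP/(_ _ d0)[U hU] := hg i.
  by exists U => V /hU; rewrite -big_mkcond.
(* [V] contains [A] and a good part of every fibre over [B], but nothing outside these fibres, so
   its sum splits exactly along [B]. *)
pose V := [fset t in (A `|` \bigcup_(i <- B) (sval (hg i)))%fset | phi t \in B]%fset.
have VE : \sum_(t <- V) f t = \sum_(i <- B) \sum_(t <- V | phi t == i) f t.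
  rewrite (exchange_big_dep predT) //= big_seq [RHS]big_seq; apply: eq_bigr => t.
  rewrite !inE /= => /andP[_ tB].
  rewrite [RHS]big_mkcond (big_fsetD1 (phi t)) //= eqxx big1_fset ?addr0 // => i.
  by rewrite !inE eq_sym => /andP[/negbTE ->].
have AV : (A `<=` V)%fset.
  apply/fsubsetP => t tA; rewrite !inE tA /=.
  by apply: (fsubsetP AB); apply/imfsetP; exists t.
rewrite [X in X < _](_ : _ = `|(l - \sum_(t <- V) f t) +
   (\sum_(t <- V) f t - \sum_(i <- B) g i)|); last by rewrite subrKA.
apply: le_lt_trans (ler_normD _ _) _.
rewrite [ltRHS](splitr e) ltr_leD ?hA // VE -sumrB.
apply: le_trans (ler_norm_sum _ _ _) _.
apply: (@le_trans _ _ (\sum_(i <- B) e / 2 / (#|` B|%:R + 1))).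
  rewrite big_seq [leRHS]big_seq; apply: ler_sum => i iB; rewrite distrC ltW //.
  (* [hg] needs its own part of fibre [i] to be included; the points of that part lying over [i] are
     already in [V]. *)
  pose W := (V `|` sval (hg i))%fset.
  have -> : \sum_(t <- V | phi t == i) f t = \sum_(t <- W | phi t == i) f t.
    rewrite [LHS]big_mkcond [RHS]big_mkcond /=; apply: big_fset_incl.
      exact: fsubsetUl.
    move=> t; rewrite in_fsetU => /orP[->//|tU].
    rewrite !inE; case: eqP => // ->; rewrite iB andbT orbC.
    by case/negP; apply/orP; left; apply/bigfcupP; exists i => //; rewrite iB.
  by apply: (svalP (hg i)); rewrite fsubsetUr.
rewrite big_const_seq count_predT iter_addr_0 -[leLHS]mulr_natr -mulrA ger_pMr //.
by rewrite mulrC ler_pdivrMr ?mul1r ?lerDl // ltr_wpDl.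
Qed.

End UnconditionalSums.

Section SumManipulation.
Variable C : numFieldType.

Lemma has_sum_reindex (T U : choiceType) (h : U -> T) (f : T -> C) (l : C) :
  injective h -> (forall t, (forall u, h u <> t) -> f t = 0) ->
  has_sum f l <-> has_sum (f \o h) l.
Proof.
move=> hI f0; split=> hf.
  apply/has_sumP => e e0; have /has_sumP/(_ _ e0)[A hA] := hf.
  have [A' hA'] : exists A' : {fset U}, forall u, h u \in A -> u \in A'.
    exists [fset u in pmap (fun t => if pselect (exists u, h u = t) is left e
                                      then Some (sval (cid e)) else None)
                           (enum_fset A)]%fset => u uA.
    rewrite !inE mem_pmap; apply/mapP; exists (h u) => //.
    case: pselect => [p|[]]; last by exists u.
    by congr Some; apply: hI; rewrite (svalP (cid p)).
  exists A' => B AB; have := hA (h @` B `|` A)%fset (fsubsetUr _ _).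
  rewrite -(big_fset_incl _ (fsubsetUl (h @` B) A)%fset) => [|t].
    by rewrite big_imfset //= => x y _ _; apply: hI.
  rewrite in_fsetU => /orP[->//|tA] tB; apply: f0 => u ut.
  by case/negP: tB; apply/imfsetP; exists u => //=; apply: (fsubsetP AB); apply: hA'; rewrite ut.
(* Each fibre of the injective [h] has at most one point, and over an empty fibre [f] vanishes. *)
apply: (has_sum_fibre (phi := h)) hf _ => t.
case: (pselect (exists u, h u = t)) => [[u ut]|nt].
  have -> : f t = \sum_(v <- [fset u]%fset) (if h v == t then (f \o h) v else 0).
    by rewrite big_seq_fset1 ut eqxx /= ut.
  by apply: has_sum_fset => v; rewrite inE -ut => /eqP vu; case: eqP => // /hI.
rewrite f0 => [|u ut]; last by apply: nt; exists u.
rewrite [X in has_sum _ X](_ : 0 = \sum_(v <- (fset0 : {fset U}))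
  (if h v == t then (f \o h) v else 0)); last by rewrite big_seq big1.
by apply: has_sum_fset => v _; case: eqP => // e; case: nt; exists v.
Qed.

Lemma has_sum_prod (T U : choiceType) (f : T * U -> C) (g : T -> C) (l : C) :
  has_sum f l -> (forall t, has_sum (fun u => f (t, u)) (g t)) -> has_sum g l.
Proof.
move=> hf hg; apply: (has_sum_fibre (phi := fst)) hf _ => t.
apply/(has_sum_reindex (h := fun u => (t, u))).
- by move=> u v [].
- by case=> t' u h /=; case: eqP => // e; case: (h u); rewrite e.
- by apply: eq_has_sum (hg t) => u /=; rewrite eqxx.
Qed.

Lemma has_sum_tensor (T U : choiceType) (f : T -> C) (g : U -> C) (a b l : C) :
  has_sum f a -> has_sum g b -> has_sum (fun x => f x.1 * g x.2) l -> l = a * b.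
Proof.
move=> hf hg hl; have h1 : has_sum (fun t => f t * b) l.
  by apply: has_sum_prod hl _ => t /=; apply: has_sumZ.
apply: has_sum_unique h1 _.
by rewrite mulrC; apply: eq_has_sum (has_sumZ b hf) => t; rewrite mulrC.
Qed.

Lemma has_sum_succ (f : nat -> C) (l : C) :
  f 0%N = 0 -> has_sum f l <-> has_sum (fun n => f n.+1) l.
Proof.
move=> f0; apply: (has_sum_reindex (h := succn)) => [m n []//|[|n] h //].
by case: (h n).
Qed.

Lemma has_sum_shift (f : nat -> C) (l : C) :
  has_sum f l -> has_sum (fun n => if n is m.+1 then f m else 0) l.
Proof. by move=> h; apply/has_sum_succ. Qed.

Lemma abs_summable_le (T : choiceType) (f g : T -> C) (K : C) :
  abs_summable g -> 0 <= K -> (forall t, `|f t| <= K * `|g t|) -> abs_summable f.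
Proof.
move=> [M hM] K0 h; exists (K * M) => A.
apply: (@le_trans _ _ (\sum_(i <- A) K * `|g i|)); first exact: ler_sum.
by rewrite -mulr_sumr ler_wpM2l.
Qed.

Lemma abs_summable_tensor (T U : choiceType) (f : T -> C) (g : U -> C) :
  abs_summable f -> abs_summable g -> abs_summable (fun x => f x.1 * g x.2).
Proof.
move=> [M hM] [N hN]; exists (M * N) => A.
pose A1 := (fst @` A)%fset; pose A2 := (snd @` A)%fset.
have N0 : 0 <= N by apply: le_trans (hN fset0); rewrite big_seq big1.
apply: (@le_trans _ _ (\sum_(t <- A1) `|f t| * N)); last first.
  by rewrite -mulr_suml ler_wpM2r.
have -> : \sum_(x <- A) `|f x.1 * g x.2| =
    \sum_(t <- A1) \sum_(x <- A | x.1 == t) `|f x.1 * g x.2|.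
  rewrite (exchange_big_dep predT) //= big_seq [RHS]big_seq; apply: eq_bigr => x xA.
  rewrite [RHS]big_mkcond (big_fsetD1 x.1) /=; last by apply/imfsetP; exists x.
  rewrite eqxx big1_fset ?addr0 // => t.
  by rewrite !inE eq_sym => /andP[/negbTE ->].
apply: ler_sum => t _.
rewrite (eq_bigr (fun x => `|f t| * `|g x.2|)) => [|x /eqP <-]; last exact: normrM.
rewrite -mulr_sumr ler_wpM2l // big_fset_condE.
have : {in [fset x in A | x.1 == t]%fset, forall x, x.1 = t}.
  by move=> x; rewrite !inE => /andP[_ /eqP].
move: [fset x in A | _]%fset => B hB; apply: le_trans (hN (snd @` B)%fset).
by rewrite big_imfset //= => [[x u] [y v]] /hB /= -> /hB /= -> ->.
Qed.

Lemma geom_sum_le (r : C) (A : {fset nat}) :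
  0 <= r < 1 -> \sum_(i <- A) r ^+ i <= (1 - r)^-1.
Proof.
case/andP => r0 r1.
pose N := (\max_(i <- A) i).+1.
have AN i : i \in A -> (i < N)%N by move=> iA; rewrite ltnS (big_rem i) //= leq_maxl.
apply: (@le_trans _ _ (\sum_(0 <= i < N) r ^+ i)).
  rewrite [leRHS](bigID (mem A)) /= -[leLHS]addr0 lerD ?sumr_ge0 // => [|i _]; last exact: exprn_ge0.
  rewrite -[leRHS]big_filter le_eqVlt; apply/orP; left; apply/eqP/perm_big/uniq_perm; first exact: fset_uniq.
    by rewrite filter_uniq // iota_uniq.
  by move=> i; rewrite mem_filter mem_index_iota /=; case: (boolP (i \in A)) => // /AN ->.
have r10 : 0 < 1 - r by rewrite subr_gt0.
rewrite -[leRHS]mul1r ler_pdivlMr // big_mkord mulrC -opprB mulNr -subrX1 opprB.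
by rewrite gerBl exprn_ge0.
Qed.

Lemma abs_summable_geom (r : C) : `|r| < 1 -> abs_summable (fun n : nat => r ^+ n).
Proof.
move=> r1; exists (1 - `|r|)^-1 => A.
by under eq_bigr do rewrite normrX; rewrite geom_sum_le ?normr_ge0.
Qed.

Lemma has_sum_norm_le (T : choiceType) (f : T -> C) (l M : C) :
  has_sum f l -> (forall A : {fset T}, \sum_(i <- A) `|f i| <= M) -> `|l| <= M.
Proof.
move=> /has_sumP hf hM; apply/ler_addgt0Pr => e /hf[A /(_ A (fsubset_refl _)) hA].
rewrite -[l](subrK (\sum_(i <- A) f i)); apply: le_trans (ler_normD _ _) _.
by rewrite addrC lerD ?(ltW hA) //; apply: le_trans (hM A); exact: ler_norm_sum.
Qed.

Lemma has_sum_behead (f : nat -> C) (l : C) :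
  has_sum f l -> has_sum (fun n => f n.+1) (l - f 0%N).
Proof.
move=> hf; pose d n := if n == 0%N then f 0%N else 0.
have hd : has_sum d (f 0%N).
  have -> : f 0%N = \sum_(n <- [fset 0%N]%fset) d n by rewrite big_seq_fset1.
  apply: has_sum_fset => n.
  by rewrite inE /d => /negbTE ->.
have /has_sum_succ : has_sum (fun n => f n + -1 * d n) (l - f 0%N).
  by rewrite -[- f 0%N]mulN1r; apply: has_sumD => //; apply: has_sumZ.
by move=> h; apply: eq_has_sum (h _) => [n|]; rewrite /d /=; ring.
Qed.

Lemma has_sum_tail (f : nat -> C) (l K r : C) :
  0 <= r < 1 -> 0 <= K -> has_sum f l -> (forall n, `|f n.+1| <= K * r ^+ n) ->
  `|l - f 0%N| <= K / (1 - r).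
Proof.
move=> r01 K0 hf hK; apply: has_sum_norm_le (has_sum_behead hf) _ => A.
apply: (@le_trans _ _ (\sum_(i <- A) K * r ^+ i)); first exact: ler_sum.
by rewrite -mulr_sumr ler_wpM2l // geom_sum_le.
Qed.

End SumManipulation.

(** * Absolutely summable complex families *)

Section Existence.
Variable R : realType.
Local Notation C := (R[i] : numFieldType).

Lemma normc_i : `|'i%C : C| = 1.
Proof. by rewrite normc_def /= expr0n expr1n add0r sqrtr1. Qed.

Lemma normc_real (x : R) : `|x%:C : C| = `|x|%:C.
Proof. by rewrite normc_def /= expr0n addr0 sqrtr_sqr. Qed.

Lemma real_nneg_has_sum (T : choiceType) (f : T -> R) (M : R) :
  (forall t, 0 <= f t) -> (forall A : {fset T}, \sum_(i <- A) f i <= M) ->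
  exists l, has_sum f l.
Proof.
move=> f0 hM; pose S := [set s | exists A : {fset T}, s = \sum_(i <- A) f i].
have hS : has_sup S.
  split; first by exists (\sum_(i <- fset0) f i); exists fset0.
  by exists M => s [A ->].
exists (sup S); apply/has_sumP => e e0.
have [s [A ->] hA] := sup_adherent e0 hS.
exists A => B AB; have hB : \sum_(i <- B) f i <= sup S.
  by apply: ub_le_sup; [case: hS|exists B].
rewrite ger0_norm ?subr_ge0 // ltrBlDr -ltrBlDl.
apply: lt_le_trans hA _.
rewrite [leRHS](big_fsetID _ (mem A)) /= -[leLHS]addr0 lerD ?sumr_ge0 //.
by rewrite (_ : [fset x in B | x \in A]%fset = A) //; apply/fsetP => t; rewrite !inE /=; case: (boolP (t \in A)) => tA; rewrite ?andbF //= (fsubsetP AB).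
Qed.

(** [f] is [|f| + f] minus [|f|], both nonnegative with bounded finite sums. *)
Lemma real_has_sum (T : choiceType) (f : T -> R) (M : R) :
  (forall A : {fset T}, \sum_(i <- A) `|f i| <= M) -> exists l, has_sum f l.
Proof.
move=> hM; have [|a ha] := @real_nneg_has_sum _ (fun t => `|f t|) M _ hM; first by [].
have [||b hb] := @real_nneg_has_sum _ (fun t => `|f t| + f t) (M + M).
- by move=> t; rewrite -[X in _ + X]opprK subr_ge0 -normrN ler_norm.
- by move=> A; rewrite big_split lerD //; apply: le_trans (hM A); apply: ler_sum => i _; exact: ler_norm.
exists (b + -1 * a); apply: eq_has_sum (has_sumD hb (has_sumZ (-1) ha)) => t.
by ring.
Qed.

Lemma has_sum_complex (T : choiceType) (f : T -> C) (a b : R) :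
  has_sum (fun t => complex.Re (f t)) a -> has_sum (fun t => complex.Im (f t)) b ->
  has_sum f (a +i* b)%C.
Proof.
move=> /has_sumP ha /has_sumP hb; apply/has_sumP => e e0.
(* The order of [R[i]] compares only numbers with equal imaginary parts, so a positive [e] is
   real. *)
have eE : e = (complex.Re e)%:C by apply/eqP; move: e0; rewrite ltcE /= => /andP[]; case: (e) => x y /=; rewrite eq_complex /= eqxx.
have r0 : 0 < complex.Re e by move: e0; rewrite eE ltcR.
have r20 : 0 < complex.Re e / 2 by rewrite divr_gt0.
have [A hA] := ha _ r20; have [B hB] := hb _ r20.
exists (A `|` B)%fset => D; rewrite fsubUset => /andP[/hA hAD /hB hBD].
have rE : complex.Re ((a +i* b)%C - \sum_(i <- D) f i) = a - \sum_(i <- D) complex.Re (f i).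
  by rewrite raddfB raddf_sum.
have iE : complex.Im ((a +i* b)%C - \sum_(i <- D) f i) = b - \sum_(i <- D) complex.Im (f i).
  by rewrite raddfB raddf_sum.
rewrite [X in `|X|]complexE rE iE.
apply: le_lt_trans (ler_normD _ _) _; rewrite normrM normc_i mul1r.
by rewrite eE !normc_real -rmorphD ltcR [ltRHS]splitr ltrD.
Qed.

(** Completeness of [R] enters here, through suprema of finite sums built from the real and
    imaginary parts. *)
Lemma abs_summable_has_sum (T : choiceType) (f : T -> C) :
  abs_summable f -> exists l, has_sum f l.
Proof.
move=> [M hM].
have hN (g : T -> R) : (forall t, `|g t|%:C <= `|f t|) ->
    forall A : {fset T}, \sum_(i <- A) `|g i| <= complex.Re M.
  move=> hg A; have := hM A.
  rewrite (eq_bigr (fun t => (complex.Re `|f t|)%:C)) => [|t _]; last by rewrite RRe_real ?normr_real.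
  rewrite -rmorph_sum lecE /= => /andP[_]; apply: le_trans; apply: ler_sum => t _.
  by rewrite -lecR; exact: hg.
have hIm (x : C) : `|complex.Im x|%:C <= `|x|.
  by have := normc_ge_Re (x * 'i); rewrite ReiNIm normrN normrM normc_i mulr1.
have [a ha] := real_has_sum (hN _ (fun t => normc_ge_Re (f t))).
have [b hb] := real_has_sum (hN (fun t => complex.Im (f t)) (fun t => hIm (f t))).
by exists (a +i* b)%C; apply: has_sum_complex.
Qed.

Lemma expr_lt_small (r e : C) : `|r| < 1 -> 0 < e ->
  exists N, forall n, (N <= n)%N -> `|r| ^+ n < e.
Proof.
move=> r1 e0.
have rE : `|r| = (complex.Re `|r|)%:C by rewrite RRe_real ?normr_real.
have eE : e = (complex.Re e)%:C by rewrite RRe_real // gtr0_real.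
have n0 : 0 <= complex.Re `|r| by have := normr_ge0 r; rewrite rE lecR.
have n1 : `|complex.Re `|r| | < 1.
  by rewrite ger0_norm //; move: r1; rewrite rE ltcR.
have e'0 : 0 < complex.Re e by rewrite -ltcR -eE.
have /cvgrPdist_lt/(_ _ e'0)[N _ hN] := cvg_expr n1.
exists N => n /hN; rewrite /= sub0r normrN normrX -ltcR -eE rmorphXn /=.
by rewrite (ger0_norm n0) -rE.
Qed.

End Existence.

(** * Infinite products, Euler's theorem and the Jacobi triple product *)

Section QPochhammer.
Variable C : numFieldType.
Implicit Types (a p z : C) (m n : nat).

Lemma qpoch0 a p : qpoch a p 0 = 1.
Proof. by rewrite /qpoch big_ord0. Qed.

Lemma qpochS a p n : qpoch a p n.+1 = qpoch a p n * (1 - a * p ^+ n).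
Proof. by rewrite /qpoch big_ord_recr. Qed.

Lemma qpochSl a p n : qpoch a p n.+1 = (1 - a) * qpoch (a * p) p n.
Proof.
rewrite /qpoch big_ord_recl /= expr0 mulr1; congr (_ * _).
by apply: eq_bigr => i _; rewrite /bump /= add1n exprS mulrA.
Qed.

Lemma qpochD a p m n : qpoch a p (m + n) = qpoch a p m * qpoch (a * p ^+ m) p n.
Proof.
elim: n => [|n IHn]; first by rewrite addn0 qpoch0 mulr1.
by rewrite addnS !qpochS IHn exprD; ring.
Qed.

Lemma subr1_neq0 z : `|z| < 1 -> 1 - z != 0.
Proof. by move=> z1; rewrite subr_eq0; apply: contraTneq z1 => <-; rewrite normr1 ltxx. Qed.

Lemma qpoch_neq0 a p n : `|a| < 1 -> `|p| < 1 -> qpoch a p n != 0.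
Proof.
move=> a1 p1; apply/prodf_neq0 => k _; apply: subr1_neq0.
by rewrite normrM normrX; apply: le_lt_trans a1; rewrite ler_piMr // exprn_ile1 // ltW.
Qed.

(** Weierstrass' product inequality. *)
Lemma prod_1sub_ge (x : nat -> C) m n : (forall k, 0 <= x k <= 1) ->
  1 - \sum_(m <= k < n) x k <= \prod_(m <= k < n) (1 - x k).
Proof.
move=> hx; have [nm|] := leqP n m; first by rewrite !big_geq // subr0.
move=> /ltnW /subnKC <-; elim: (n - m)%N => [|l IH]; first by rewrite addn0 !big_geq // subr0.
rewrite addnS !big_nat_recr ?leq_addr //=.
have /andP[x0 x1] := hx (m + l)%N; set S := \sum_(_ <= _ < _) _ in IH *.
apply: le_trans (ler_wpM2r _ IH); last by rewrite subr_ge0.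
have S0 : 0 <= S by apply: sumr_ge0 => k _; case/andP: (hx k).
rewrite (_ : (1 - S) * _ = 1 - (S + x (m + l)%N) + S * x (m + l)%N); last by ring.
by rewrite lerDl mulr_ge0.
Qed.

End QPochhammer.

Section SelfPochhammer.
Variable R : realType.
Local Notation C := (R[i] : numFieldType).
Variable p : C.
Hypotheses (p0 : p != 0) (p1 : `|p| < 1).
Implicit Types (a z : C) (m n d b : nat).

Lemma normrX_le1 n : `|p| ^+ n <= 1.
Proof. by rewrite exprn_ile1 // ltW. Qed.

(** Each factor satisfies |1 - p^(k + 1)| >= 1 - |p|^(k + 1). [N] is so large that the later powers
    sum to at most 1/2, hence the tail of the product is at least 1/2 by Weierstrass' inequality;
    the first [N] factors contribute [A]. *)
Lemma qpochV_bounded : exists2 K : C, 0 < K & forall n, `|(qpoch p p n)^-1| <= K.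
Proof.
have r10 : 0 < 1 - `|p| by rewrite subr_gt0.
have e0 : 0 < (1 - `|p|) / 2 by rewrite divr_gt0.
have [N hN] := expr_lt_small p1 e0.
pose x k : C := `|p| ^+ k.+1.
have x01 k : 0 <= x k <= 1 by rewrite exprn_ge0 //= normrX_le1.
pose A := \prod_(0 <= k < N) (1 - x k).
have A0 : 0 < A.
  by apply: prodr_gt0 => k _; rewrite subr_gt0 /x exprn_ilt1.
have B0 n : 1 / 2 <= \prod_(N <= k < N + n) (1 - x k).
  apply: le_trans (prod_1sub_ge N (N + n) x01).
  rewrite lerBrDr -lerBrDl.
  rewrite -{1}[N]add0n big_addn addKn big_mkord.
  rewrite (eq_bigr (fun i : 'I_n => `|p| ^+ N.+1 * `|p| ^+ i)) => [|i _]; last first.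
    by rewrite /x -exprD; congr (_ ^+ _); lia.
  rewrite -mulr_sumr; apply: (@le_trans _ _ (`|p| ^+ N.+1 * (1 - `|p|)^-1)).
    rewrite ler_wpM2l ?exprn_ge0 //.
    rewrite -(big_mkord xpredT (fun i => `|p| ^+ i)) /index_iota subn0.
    rewrite (_ : \sum_(i <- iota 0 n) _ = \sum_(i <- [fset i in iota 0 n]%fset) `|p| ^+ i).
      by apply: geom_sum_le; rewrite normr_ge0.
    by apply/perm_big/uniq_perm; rewrite ?iota_uniq ?fset_uniq // => i; rewrite !inE.
  rewrite ler_pdivrMr //; apply: le_trans (ltW (hN N.+1 (leqnSn N))) _.
  by rewrite le_eqVlt; apply/orP; left; apply/eqP; field.
exists (2 / A); first by rewrite divr_gt0.
move=> n; rewrite normfV -[leRHS]invrK invf_div lef_pV2 ?posrE ?divr_gt0 //; last first.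
  by rewrite normr_gt0 qpoch_neq0.
apply: (@le_trans _ _ (\prod_(0 <= k < N + n) (1 - x k))).
  by rewrite (big_cat_nat (n := N)) ?leq_addr //= -/A ler_pM2l // -[2^-1]mul1r.
rewrite addnC (big_cat_nat (n := n)) ?leq_addr //= -[leRHS]mulr1.
have h01 k : 0 <= 1 - x k <= 1.
  by case/andP: (x01 k) => x0 x1; rewrite subr_ge0 x1 gerBl.
apply: ler_pM; rewrite ?prodr_ge0 //; try by move=> i _; case/andP: (h01 i).
  rewrite big_mkord /qpoch normr_prod; apply: ler_prod => i _.
  rewrite (andP (h01 i)).1 /= -exprS.
  by have := lerB_dist 1 (p ^+ i.+1); rewrite normr1 normrX.
by apply: prodr_ile1 => i _; exact: h01.
Qed.

End SelfPochhammer.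

Section Euler.
Variable R : realType.
Local Notation C := (R[i] : numFieldType).
Variable p : C.
Hypotheses (p0 : p != 0) (p1 : `|p| < 1).
Implicit Types (a z : C) (m n d b : nat).

Lemma abs_summable_ratio (f : nat -> C) (K r : C) :
  0 < `|r| < 1 -> 0 <= K -> (forall n, `|f n.+1| <= K * `|r| ^+ n) -> abs_summable f.
Proof.
case/andP => r0 r1 K0 h.
apply: (@abs_summable_le _ _ _ _ (`|f 0%N| + K / `|r|) (abs_summable_geom r1)).
  by rewrite addr_ge0 // divr_ge0 // ltW.
case=> [|n]; rewrite normrX; first by rewrite expr0 mulr1 lerDl divr_ge0 // ltW.
apply: le_trans (h n) _; rewrite mulrDl -[leLHS]add0r lerD ?mulr_ge0 ?exprn_ge0 //.
by rewrite exprS mulrA divfK // gt_eqF.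
Qed.

(** General term of Euler's expansion of (- z; p)_inf. *)
Definition euler_term z n : C := p ^+ 'C(n, 2) * z ^+ n / qpoch p p n.

Lemma qpoch_self_neq0 n : qpoch p p n != 0.
Proof. exact: qpoch_neq0. Qed.

Lemma euler_term_rec z n :
  euler_term z n = euler_term (z * p) n +
    z * (if n is m.+1 then euler_term (z * p) m else 0).
Proof.
case: n => [|m]; first by rewrite /euler_term !expr0 mulr0 addr0.
rewrite /euler_term binS bin1 qpochS exprD !exprMn !exprS.
have h1 := qpoch_self_neq0 m; have := qpoch_self_neq0 m.+1.
rewrite qpochS mulf_eq0 negb_or => /andP[_ h2].
by field; rewrite h1.
Qed.

(** The functional equation L(z) = (1 + z) L(z p) of (- z; p)_inf, read off termwise. *)
Lemma has_sum_euler_step z l :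
  has_sum (euler_term (z * p)) l -> has_sum (euler_term z) ((1 + z) * l).
Proof.
move=> h; rewrite mulrDl mul1r.
apply: eq_has_sum (has_sumD h (has_sumZ z (has_sum_shift h))) => n /=.
by rewrite [RHS]euler_term_rec.
Qed.

Lemma has_sum_euler_iter z l n :
  has_sum (euler_term (z * p ^+ n)) l -> has_sum (euler_term z) (qpoch (- z) p n * l).
Proof.
elim: n l => [|n IH] l; first by rewrite expr0 mulr1 qpoch0 mul1r.
rewrite exprSr mulrA => /has_sum_euler_step /IH.
by rewrite qpochS mulNr opprK mulrA.
Qed.

(** The factor [|z|] in the bound gives L(z) -> 1 as z -> 0, the boundary value that singles out the
    solution of the functional equation. *)
Lemma has_sum_euler_small : exists2 K, 0 <= K & forall z, `|z| <= 1 ->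
  exists2 l, has_sum (euler_term z) l & `|l - 1| <= K * `|z|.
Proof.
have [K K0 hK] := qpochV_bounded p0 p1.
have r10 : 0 < 1 - `|p| by rewrite subr_gt0.
have pp0 : 0 < `|p| by rewrite normr_gt0.
exists (K / (1 - `|p|)) => [|z z1]; first by rewrite divr_ge0 // ltW.
have h n : `|euler_term z n.+1| <= K * `|z| * `|p| ^+ n.
  have -> : `|euler_term z n.+1| =
      `|(qpoch p p n.+1)^-1| * (`|z| ^+ n.+1 * `|p| ^+ 'C(n.+1, 2)).
    by rewrite /euler_term !normrM !normrX mulrC [X in _ * X]mulrC.
  rewrite -mulrA; apply: ler_pM; rewrite ?mulr_ge0 ?exprn_ge0 //.
  apply: ler_pM; rewrite ?exprn_ge0 //.
    by rewrite exprS ler_piMr // exprn_ile1.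
  by apply: ler_wiXn2l; rewrite ?ltW // binS bin1 leq_addl.
have [l hl] : exists l, has_sum (euler_term z) l.
  apply: abs_summable_has_sum; apply: (@abs_summable_ratio _ _ p _ _ h); first by rewrite pp0.
  by rewrite mulr_ge0 // ltW.
exists l => //; rewrite mulrAC.
rewrite [X in l - X](_ : _ = euler_term z 0); last first.
  by rewrite /euler_term qpoch0 bin_small // !expr0 mulr1 divr1.
by apply: has_sum_tail h; rewrite ?normr_ge0 ?mulr_ge0 // ltW.
Qed.

Lemma cvg_nat_dist_lt (u : nat -> C) (l : C) :
  (forall e : C, 0 < e -> exists N, forall n, (N <= n)%N -> `|l - u n| < e) ->
  u @ \oo --> l.
Proof.
by move=> h; apply/cvgrPdist_lt => e /h[N hN]; exists N.
Qed.

Lemma cvg_le_geom (u : nat -> C) (l K : C) : 0 <= K ->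
  (forall n, `|l - u n| <= K * `|p| ^+ n) -> u @ \oo --> l.
Proof.
move=> K0 h; apply: cvg_nat_dist_lt => e e0.
have e'0 : 0 < e / (K + 1) by rewrite divr_gt0 // ltr_wpDl.
have [N hN] := expr_lt_small p1 e'0; exists N => n /hN hn.
apply: le_lt_trans (h n) _; rewrite ltr_pdivlMr ?ltr_wpDl // in hn.
by apply: le_lt_trans hn; rewrite mulrC ler_wpM2l ?exprn_ge0 // lerDl.
Qed.

(** For large [N] the point z p^N lies in the unit disc, and the functional equation carries
    summability from there to [z]. *)
Lemma euler_sums : exists2 L : C -> C, (forall z, has_sum (euler_term z) (L z)) &
  (forall z, L (z * p ^+ n) @[n --> \oo] --> (1 : C)).
Proof.
have [K K0 hK] := has_sum_euler_small.
have ex z : exists l, has_sum (euler_term z) l.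
  have z0 : 0 < (`|z| + 1)^-1 by rewrite invr_gt0 ltr_wpDl.
  have [N /(_ N (leqnn N)) hN] := expr_lt_small p1 z0.
  have [|l hl _] := hK (z * p ^+ N).
    rewrite normrM normrX; apply: (@le_trans _ _ (`|z| * (`|z| + 1)^-1)).
      by rewrite ler_wpM2l // ltW.
    by rewrite ler_pdivrMr ?mul1r ?lerDl // ltr_wpDl.
  by exists (qpoch (- z) p N * l); apply: has_sum_euler_iter.
exists (fun z => sval (cid (ex z))) => z; first exact: (svalP (cid (ex z))).
have zN n : `|z * p ^+ n| <= `|z| * `|p| ^+ n by rewrite normrM normrX.
have z0 : 0 < (`|z| + 1)^-1 by rewrite invr_gt0 ltr_wpDl.
have [N hN] := expr_lt_small p1 z0.
apply: cvg_nat_dist_lt => e e0.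
have e'0 : 0 < e / (K * `|z| + 1) by rewrite divr_gt0 // ltr_wpDl ?mulr_ge0.
have [M hM] := expr_lt_small p1 e'0; exists (N + M)%N => n hn.
have [|l hl hl1] := hK (z * p ^+ n).
  rewrite normrM normrX; apply: (@le_trans _ _ (`|z| * (`|z| + 1)^-1)).
    by rewrite ler_wpM2l // ltW // hN //; lia.
  by rewrite ler_pdivrMr ?mul1r ?lerDl // ltr_wpDl.
rewrite (has_sum_unique (svalP (cid (ex (z * p ^+ n)))) hl) distrC.
apply: le_lt_trans hl1 _; have := hM n; rewrite ltr_pdivlMr ?ltr_wpDl ?mulr_ge0 //.
move=> /(_ ltac:(lia)); apply: le_lt_trans; rewrite normrM normrX mulrA mulrC.
by rewrite ler_wpM2l ?exprn_ge0 // lerDl.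
Qed.

(** Convergence of the product is deduced from the series: by the iterated functional equation
    [qpoch a p n] equals L(- a) / L(- a p^n) once the denominator is nonzero, and the denominator
    tends to 1. *)
Lemma qpoch_cvg_euler a : exists2 l, has_sum (euler_term (- a)) l &
  qpoch a p n @[n --> \oo] --> l.
Proof.
case: euler_sums => L hL L1; exists (L (- a)); first exact: hL.
have LE n : L (- a) = qpoch a p n * L (- a * p ^+ n).
  have := @has_sum_euler_iter (- a) _ n (hL _).
  by rewrite opprK; apply: has_sum_unique.
have h2 : L (- a) * (L (- a * p ^+ n))^-1 @[n --> \oo] --> L (- a) * 1^-1.
  apply: cvgM; first exact: cvg_cst.
  by apply: cvgV (L1 (- a)); exact: oner_neq0.
rewrite invr1 mulr1 in h2.
apply: cvg_trans h2; apply: near_eq_cvg.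
have := L1 (- a); move/cvgrPdist_lt => /(_ 1 ltr01) [N _ hN].
exists N => // n /hN /=; set w := L _ => hw.
have w0 : w != 0 by apply: contraTneq hw => ->; rewrite subr0 normr1 ltxx.
by rewrite (LE n) -/w mulfK.
Qed.

Lemma qpoch_cvg a : qpoch a p n @[n --> \oo] --> qpoch_inf a p.
Proof. by have [l _ h] := qpoch_cvg_euler a; apply/cvg_ex; exists l. Qed.

Lemma has_sum_euler z : has_sum (euler_term z) (qpoch_inf (- z) p).
Proof.
have [l hl h] := qpoch_cvg_euler (- z); rewrite opprK in hl.
by rewrite /qpoch_inf (cvg_lim _ h) //; exact: norm_hausdorff.
Qed.

Lemma qpoch_inf_split a n : qpoch_inf a p = qpoch a p n * qpoch_inf (a * p ^+ n) p.
Proof.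
have h1 := has_sum_euler (- a); rewrite opprK in h1; apply: has_sum_unique h1 _.
have := @has_sum_euler_iter (- a) (qpoch_inf (a * p ^+ n) p) n; rewrite opprK; apply.
by have := has_sum_euler (- a * p ^+ n); rewrite -mulNr opprK.
Qed.

(** A late tail is an Euler sum at distance less than 1 from 1. *)
Lemma qpoch_inf_neq0 a : `|a| < 1 -> qpoch_inf a p != 0.
Proof.
move=> a1; case: euler_sums => L hL L1.
have /cvgrPdist_lt /(_ 1 ltr01) [N _ /(_ N (leqnn N)) /= hw] := L1 (- a).
rewrite (qpoch_inf_split a N) mulf_neq0 ?qpoch_neq0 //.
have := has_sum_unique (has_sum_euler (- a * p ^+ N)) (hL _).
rewrite mulNr opprK -mulNr => ->.
by apply: contraTneq hw => ->; rewrite subr0 normr1 ltxx.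
Qed.

End Euler.

(** * The Durfee rectangle series *)

Section DurfeeSeries.
Variable R : realType.
Local Notation C := (R[i] : numFieldType).
Variable p : C.
Hypotheses (p0 : p != 0) (p1 : `|p| < 1).
Implicit Types (a z : C) (m n d b : nat).

(** p^(b (b + d)) stands for the Durfee rectangle with sides b and b + d, the two denominators for
    the partitions beside and below it. *)
Definition durfee_term d b : C :=
  p ^+ (b * b + b * d) / (qpoch p p b * qpoch p p (b + d)).

Let qn n : qpoch p p n != 0.
Proof. exact: qpoch_self_neq0. Qed.

Let q1n n : 1 - p ^+ n.+1 != 0.
Proof. by apply: subr1_neq0; rewrite normrX exprn_ilt1. Qed.

Lemma durfee_bound : exists2 K, 0 <= K & forall d, exists2 l,
  has_sum (durfee_term d) l & `|l| <= K /\ `|l - (qpoch p p d)^-1| <= K * `|p| ^+ d.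
Proof.
have [K K0 hK] := qpochV_bounded p0 p1.
have r10 : 0 < 1 - `|p| by rewrite subr_gt0.
have pp0 : 0 < `|p| by rewrite normr_gt0.
have KK0 : 0 <= K * K by rewrite mulr_ge0 // ltW.
exists (K * K / (1 - `|p|)) => [|d]; first by rewrite divr_ge0 // ltW.
have hE b : `|durfee_term d b| =
    `|(qpoch p p b)^-1| * `|(qpoch p p (b + d))^-1| * `|p| ^+ (b * b + b * d).
  by rewrite /durfee_term !normrM invfM normrM normrX mulrC.
have h b : `|durfee_term d b.+1| <= K * K * `|p| ^+ d * `|p| ^+ b.
  rewrite hE -[leRHS]mulrA; apply: ler_pM; rewrite ?mulr_ge0 ?exprn_ge0 //; first exact: ler_pM.
  rewrite -exprD; apply: ler_wiXn2l; rewrite ?ltW //; nia.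
have h0 b : `|durfee_term d b| <= K * K * `|p| ^+ b.
  rewrite hE; apply: ler_pM; rewrite ?mulr_ge0 ?exprn_ge0 //; first exact: ler_pM.
  by apply: ler_wiXn2l; rewrite ?ltW //; nia.
have [l hl] : exists l, has_sum (durfee_term d) l.
  apply: abs_summable_has_sum; apply: (@abs_summable_ratio _ _ _ p _ _ h); first by rewrite pp0.
  by rewrite mulr_ge0 ?exprn_ge0.
exists l => //; split.
  apply: has_sum_norm_le hl _ => A; apply: (@le_trans _ _ (\sum_(b <- A) K * K * `|p| ^+ b)).
    exact: ler_sum.
  by rewrite -mulr_sumr ler_wpM2l // geom_sum_le // normr_ge0.
have -> : (qpoch p p d)^-1 = durfee_term d 0.
  by rewrite /durfee_term mul0n add0n expr0 qpoch0 !mul1r.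
rewrite mulrAC; apply: has_sum_tail h; rewrite ?normr_ge0 //.
by rewrite mulr_ge0 ?exprn_ge0.
Qed.

(* Calling the sums [X d], one has [X d - X (d + 1) = - p^(d + 1) (X (d + 1) - X (d + 2))];
   as [X] is bounded, it is constant, hence equal to its limit. *)
Lemma durfee_sum d : has_sum (durfee_term d) (qpoch_inf p p)^-1.
Proof.
have [K K0 hK] := durfee_bound.
have {hK} [X hX [XK Xd]] : exists2 X : nat -> C, (forall d, has_sum (durfee_term d) (X d))
    & (forall d, `|X d| <= K) /\ (forall d, `|X d - (qpoch p p d)^-1| <= K * `|p| ^+ d).
  exists (fun d => sval (cid2 (hK d))) => [e|]; first by case: (cid2 (hK e)).
  by split=> e; case: (cid2 (hK e)) => l ? [].
have rec e : X e - X e.+1 = - (p ^+ e.+1 * (X e.+1 - X e.+2)).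
  (* The combination gives the terms a factor 1 - p^b: the one at b = 0 vanishes, and the others,
     moved by one, are those of p^(e + 1) X (e + 2). *)
  pose u b := durfee_term e b + -1 * durfee_term e.+1 b + p ^+ e.+1 * durfee_term e.+1 b.
  have uE b : u b = p ^+ (b * b + b * e) * (1 - p ^+ b) / (qpoch p p b * qpoch p p (b + e.+1)).
    rewrite /u /durfee_term addnS qpochS -exprS.
    have -> : (b * b + b * e.+1 = b * b + b * e + b)%N by lia.
    have := q1n (b + e)%N; rewrite !exprS !exprD => n1.
    by field; rewrite qn n1 qn.
  have uS b : u b.+1 = p ^+ e.+1 * durfee_term e.+2 b.
    rewrite uE /durfee_term addSnnS qpochS -exprS.
    have -> : (b.+1 * b.+1 + b.+1 * e = b * b + b * e.+2 + e.+1)%N by lia.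
    by rewrite exprD; field; rewrite qn q1n qn.
  have hu : has_sum u (X e + -1 * X e.+1 + p ^+ e.+1 * X e.+1).
    by do 2![apply: has_sumD; last exact: has_sumZ].
  have := has_sum_unique (has_sum_behead hu) (eq_has_sum (fsym uS) (has_sumZ _ (hX _))).
  rewrite uE expr0 subrr mulr0 mul0r subr0 => h.
  by apply: (@addIr _ (p ^+ e.+1 * X e.+1)); move: h; rewrite mulN1r => ->; ring.
have Xc e : X e = X e.+1.
  apply/eqP; rewrite -subr_eq0 -normr_le0; apply/ler_addgt0Pr => eps eps0.
  have D n : `|X e - X e.+1| <= `|p| ^+ n * `|X (e + n)%N - X (e + n).+1|.
    elim: n => [|n IH]; first by rewrite expr0 mul1r addn0.
    apply: le_trans IH _; rewrite exprSr -mulrA ler_wpM2l ?exprn_ge0 // rec normrN normrM addnS.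
    by rewrite ler_wpM2r // normrX exprS ler_piMr // exprn_ile1 // ltW.
  have e'0 : 0 < eps / (K + K + 1) by rewrite divr_gt0 // ltr_wpDl // addr_ge0.
  have [N /(_ N (leqnn N)) hN] := expr_lt_small p1 e'0.
  rewrite add0r; apply: le_trans (D N) _.
  rewrite ltr_pdivlMr in hN; last by rewrite ltr_wpDl // addr_ge0.
  apply: le_trans (ltW hN); rewrite ler_wpM2l ?exprn_ge0 //.
  apply: le_trans (ler_normB _ _) _; apply: le_trans (lerD (XK _) (XK _)) _.
  by rewrite lerDl.
have X0 e : X e = X 0%N by elim: e => // e IH; rewrite -Xc.
suff h : (qpoch_inf p p)^-1 = X 0%N by rewrite h -(X0 d).
have h1 : (qpoch p p n)^-1 @[n --> \oo] --> X 0%N.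
  by apply: (cvg_le_geom p1 K0) => n; rewrite -{1}(X0 n).
have h2 : (qpoch p p n)^-1 @[n --> \oo] --> (qpoch_inf p p)^-1.
  have h := cvgV (qpoch_inf_neq0 p0 p1 p1) (qpoch_cvg p0 p1 (a := p)).
  exact: h.
by apply: cvg_unique h2 h1; exact: norm_hausdorff.
Qed.

End DurfeeSeries.

Section IntegerSums.
Variable C : numFieldType.

Lemma abs_summableD (T : choiceType) (f g : T -> C) :
  abs_summable f -> abs_summable g -> abs_summable (fun t => f t + g t).
Proof.
move=> [M hM] [N hN]; exists (M + N) => A.
apply: (@le_trans _ _ (\sum_(i <- A) (`|f i| + `|g i|))).
  by apply: ler_sum => i _; exact: ler_normD.
by rewrite big_split lerD.
Qed.

Lemma abs_summableZ (T : choiceType) (c : C) (f : T -> C) :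
  abs_summable f -> abs_summable (fun t => c * f t).
Proof.
by move=> hf; apply: abs_summable_le hf (normr_ge0 c) _ => t; rewrite normrM.
Qed.

Lemma abs_summable_shift (f : nat -> C) : abs_summable f ->
  abs_summable (fun n => if n is m.+1 then f m else 0).
Proof.
move=> [M hM]; exists M => A; apply: le_trans (hM (predn @` (A `\ 0))%fset).
have hI : {in (A `\ 0)%fset &, injective predn}.
  by move=> [|m] [|n]; rewrite !inE //= => _ _ ->.
rewrite big_imfset //=.
have [A0|A0] := boolP (0%N \in A); last first.
  rewrite le_eqVlt; apply/orP; left; apply/eqP; apply: eq_fbig => [i|i].
    by rewrite !inE; case: eqP => // ->; rewrite (negbTE A0).
  by case: i => // iA; rewrite iA in A0.
rewrite (big_fsetD1 0%N) //= normr0 add0r big_seq [leRHS]big_seq; apply: ler_sum => -[|i] //.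
by rewrite !inE.
Qed.

(** [Negz n] is - (n + 1), hence the offset [n.+1] on the negative diagonals. *)
Lemma has_sum_diagonals (f : nat * nat -> C) (g : int -> C) (l : C) :
  has_sum f l -> (forall n, has_sum (fun b => f (b + n, b)%N) (g (Posz n))) ->
  (forall n, has_sum (fun a => f (a, a + n.+1)%N) (g (Negz n))) -> has_sum g l.
Proof.
move=> hf hp hn.
apply: (has_sum_fibre (phi := fun x : nat * nat => (Posz x.1 - Posz x.2)%R)) hf _ => -[] n.
  apply/(has_sum_reindex (h := fun b => (b + n, b)%N)) => [b c [] //|[a b] h|].
    by case: eqP => // /= e; case: (h b); congr pair; lia.
  by apply: eq_has_sum (hp n) => b /=; case: eqP => //; lia.
apply/(has_sum_reindex (h := fun a => (a, a + n.+1)%N)) => [b c [] //|[a b] h|].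
  by case: eqP => // /= e; case: (h a); congr pair; lia.
by apply: eq_has_sum (hn n) => b /=; case: eqP => //; lia.
Qed.

(* [d (d - 1) / 2] *)
Definition triangle (d : int) : nat :=
  match d with Posz n => 'C(n, 2) | Negz n => 'C(n.+2, 2) end.

Lemma bin2_double n : ('C(n, 2) * 2 = n * n.-1)%N.
Proof. by elim: n => // n IH; rewrite binS bin1 mulnDl IH; case: n {IH} => //= n; nia. Qed.

Lemma triangle_double d : (triangle d * 2)%:Z = d * d - d.
Proof. by case: d => n; rewrite /triangle bin2_double; case: n => //= n; nia. Qed.

Lemma bin2D m n : 'C(m + n, 2) = ('C(m, 2) + 'C(n, 2) + m * n)%N.
Proof. by have := bin2_double (m + n); have := bin2_double m; have := bin2_double n; case: m => [|m]; case: n => [|n] //=; nia. Qed.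

End IntegerSums.

Section Jacobi.
Variable R : realType.
Local Notation C := (R[i] : numFieldType).
Variable p : C.
Hypotheses (p0 : p != 0) (p1 : `|p| < 1).
Implicit Types (a z : C).

Lemma abs_summable_euler z : abs_summable (euler_term p z).
Proof.
have z0 : 0 < (`|z| + 1)^-1 by rewrite invr_gt0 ltr_wpDl.
have [N /(_ N (leqnn N)) hN] := expr_lt_small p1 z0.
have : `|z * p ^+ N| <= 1.
  rewrite normrM normrX; apply: (@le_trans _ _ (`|z| * (`|z| + 1)^-1)).
    by rewrite ler_wpM2l // ltW.
  by rewrite ler_pdivrMr ?mul1r ?lerDl // ltr_wpDl.
(* Induction on the number of multiplications by [p] that bring [z] into the unit disc;
   [euler_term_rec] undoes one of them. *)
elim: N z {z0 hN} => [|N IH] z; last first.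
  rewrite exprS mulrA => /IH h.
  have [M hM] := abs_summableD h (abs_summableZ z (abs_summable_shift h)).
  by exists M => A; apply: le_trans (hM A); apply: ler_sum => n _; rewrite euler_term_rec.
rewrite expr0 mulr1 => z1; have [K K0 hK] := qpochV_bounded p0 p1.
have pp0 : 0 < `|p| by rewrite normr_gt0.
apply: (@abs_summable_ratio _ _ K p); rewrite ?pp0 // ?ltW // => n.
have -> : `|euler_term p z n.+1| =
    `|(qpoch p p n.+1)^-1| * (`|z| ^+ n.+1 * `|p| ^+ 'C(n.+1, 2)).
  by rewrite /euler_term !normrM !normrX mulrC [X in _ * X]mulrC.
apply: ler_pM; rewrite ?mulr_ge0 ?exprn_ge0 // -[leRHS]mul1r.
apply: ler_pM; rewrite ?exprn_ge0 ?exprn_ile1 //.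
by apply: ler_wiXn2l; rewrite ?ltW // binS bin1 leq_addl.
Qed.

(** The product of two Euler series is grouped by d = a - b. Each diagonal is p^(triangle d) z^d
    times a Durfee series, whose sum does not depend on d. *)
Lemma jacobi_triple z : z != 0 ->
  has_sum (fun d => p ^+ triangle d * z ^ d)
    (qpoch_inf (- z) p * qpoch_inf (- (p / z)) p * qpoch_inf p p).
Proof.
move=> z0.
have [l hl] : exists l, has_sum (fun x => euler_term p z x.1 * euler_term p (p / z) x.2) l.
  by apply: abs_summable_has_sum; apply: abs_summable_tensor; exact: abs_summable_euler.
have lE : l = qpoch_inf (- z) p * qpoch_inf (- (p / z)) p.
  by apply: has_sum_tensor hl; exact: has_sum_euler.
rewrite -lE; have P0 : qpoch_inf p p != 0 by exact: qpoch_inf_neq0.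
have qn n : qpoch p p n != 0 by exact: qpoch_self_neq0.
suff h : has_sum (fun d => p ^+ triangle d * z ^ d * (qpoch_inf p p)^-1) l.
  rewrite mulrC; apply: eq_has_sum (has_sumZ (qpoch_inf p p) h) => d.
  by rewrite mulrC mulfVK.
apply: has_sum_diagonals hl _ _ => n /=.
  apply: eq_has_sum (has_sumZ _ (durfee_sum p0 p1 n)) => b.
  rewrite /euler_term /durfee_term.
  have -> : (b * b + b * n = 'C(b, 2) + 'C(b, 2) + b + b * n)%N.
    by have := bin2_double b; case: b => //= b; nia.
  rewrite bin2D -exprnP !exprD !exprMn exprVn; field.
  by rewrite !qn expf_neq0.
apply: eq_has_sum (has_sumZ _ (durfee_sum p0 p1 n.+1)) => b.
rewrite /euler_term /durfee_term.
have -> : (b * b + b * n.+1 = 'C(b, 2) + 'C(b, 2) + b + b * n.+1)%N.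
  by have := bin2_double b; case: b => //= b; nia.
rewrite bin2D NegzE -invr_expz -exprnP (binS n.+1) bin1 !exprMn !exprVn !exprD; field.
by rewrite !qn !expf_neq0.
Qed.

End Jacobi.

Section JacobiEvenBase.
Variable R : realType.
Local Notation C := (R[i] : numFieldType).
Variable q : C.
Hypotheses (q0 : q != 0) (q1 : `|q| < 1).

Lemma jacobi_triple_sq (z : C) : z != 0 ->
  has_sum (fun d : int => q ^ (d * d) * z ^ d)
    (qpoch_inf (- (q * z)) (q ^+ 2) * qpoch_inf (- (q / z)) (q ^+ 2) * qpoch_inf (q ^+ 2) (q ^+ 2)).
Proof.
move=> z0.
have q20 : q ^+ 2 != 0 by rewrite expf_neq0.
have q21 : `|q ^+ 2| < 1 by rewrite normrX exprn_ilt1.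
have := jacobi_triple q20 q21 (mulf_neq0 q0 z0).
rewrite (_ : q ^+ 2 / (q * z) = q / z); last by field; rewrite z0 q0.
apply: eq_has_sum => d.
rewrite -exprM mulnC exprnP triangle_double exprzMl ?unitfE // mulrA -expfzDr //.
by rewrite subrK.
Qed.

End JacobiEvenBase.

(** * Reduction of the triple sum *)

Section FiniteFibres.
Variable C : numFieldType.

Lemma has_sum_fibre_seq (T I : choiceType) (phi : T -> I) (s : I -> seq T)
    (f : T -> C) (l : C) :
  (forall i, uniq (s i)) -> (forall i t, (t \in s i) = (phi t == i)) ->
  has_sum f l -> has_sum (fun i => \sum_(t <- s i) f t) l.
Proof.
move=> us ms hf; apply: has_sum_fibre hf _ => i.
rewrite (_ : \sum_(t <- s i) f t =
   \sum_(t <- [fset t in s i]%fset) (if phi t == i then f t else 0)).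
  by apply: has_sum_fset => t; rewrite !inE ms => /negbTE ->.
rewrite big_seq (eq_bigr (fun t => if phi t == i then f t else 0)) => [|t]; last first.
  by rewrite ms => ->.
rewrite -big_seq; apply/perm_big/uniq_perm; rewrite ?us ?fset_uniq // => t.
by rewrite !inE.
Qed.

Lemma has_sum_antidiagonal (f : nat * nat -> C) (l : C) : has_sum f l ->
  has_sum (fun n => \sum_(k < n.+1) f (n - k, nat_of_ord k)%N) l.
Proof.
move=> /(@has_sum_fibre_seq _ _ (fun x : nat * nat => (x.1 + x.2)%N)
  (fun n => [seq (n - k, k)%N | k <- iota 0 n.+1])) h.
apply: eq_has_sum (h _ _) => [n|n|n [a b]].
- by rewrite big_map -(big_mkord xpredT (fun k => f (n - k, k)%N)) /index_iota subn0.
- by rewrite map_inj_uniq ?iota_uniq // => a b [].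
apply/mapP/eqP => [[k] | <-]; first by rewrite mem_iota /= => kn [-> ->]; lia.
by exists b; [rewrite mem_iota /=; lia | congr pair => /=; lia].
Qed.

Lemma has_sum_antidiagonal2 (f : nat * nat -> C) (l : C) : has_sum f l ->
  has_sum (fun n => \sum_(k < n./2.+1) f (n - k.*2, nat_of_ord k)%N) l.
Proof.
move=> /(@has_sum_fibre_seq _ _ (fun x : nat * nat => (x.1 + x.2.*2)%N)
  (fun n => [seq (n - k.*2, k)%N | k <- iota 0 n./2.+1])) h.
apply: eq_has_sum (h _ _) => [n|n|n [a b]].
- by rewrite big_map -(big_mkord xpredT (fun k => f (n - k.*2, k)%N)) /index_iota subn0.
- by rewrite map_inj_uniq ?iota_uniq // => a b [].
apply/mapP/eqP => [[k] | <-]; first by rewrite mem_iota /= => kn [-> ->]; lia.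
by exists b; [rewrite mem_iota /=; lia | congr pair => /=; lia].
Qed.

End FiniteFibres.

Section DurfeeRectangle.
Variable C : numFieldType.
Variable p : C.
Hypothesis p1 : `|p| < 1.

Definition pair_sum (c : int -> C) (n : nat) : C :=
  \sum_(k < n.+1) c ((n - k)%N%:Z - k%:Z) / (qpoch p p (n - k) * qpoch p p k).

Let qn n : qpoch p p n != 0.
Proof. exact: qpoch_neq0. Qed.

Let q1n n : 1 - p ^+ n.+1 != 0.
Proof. by apply: subr1_neq0; rewrite normrX exprn_ilt1. Qed.

(* Both sides satisfy [(1 - p^I) D I K = D (I - 1) K]. *)
Lemma durfee_rectangle I K :
  \sum_(r < I.+1 | (r <= K)%N) p ^+ ((I - r) * (K - r))
     / (qpoch p p (I - r) * qpoch p p (K - r) * qpoch p p r)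
  = (qpoch p p I * qpoch p p K)^-1.
Proof.
pose t (J : nat) (r : nat) : C := if (r <= K)%N then p ^+ ((J - r) * (K - r))
     / (qpoch p p (J - r) * qpoch p p (K - r) * qpoch p p r) else 0.
rewrite big_mkcond; change (\sum_(r < I.+1) t I r = (qpoch p p I * qpoch p p K)^-1).
elim: I => [|I IH].
  by rewrite big_ord_recl big_ord0 /t /= sub0n mul0n expr0 subn0 qpoch0 addr0 mulr1 div1r.
apply: (@mulfI _ (1 - p ^+ I.+1)) => //.
rewrite [RHS](_ : _ = (qpoch p p I * qpoch p p K)^-1); last first.
  by rewrite qpochS -exprS; field; rewrite !qn q1n.
rewrite -IH mulr_sumr.
(* Here 1 - p^(I + 1) = (1 - p^(I + 1 - r)) + p^(I + 1 - r) (1 - p^r): the first part shortens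
   (p)_(I + 1 - r), the second shortens (p)_r. Once the second index is moved by one, the two pieces
   add up to the summand for I. *)
rewrite (eq_bigr (fun r : 'I_I.+2 => (1 - p ^+ (I.+1 - r)) * t I.+1 r
    + p ^+ (I.+1 - r) * (1 - p ^+ r) * t I.+1 r)) => [|r _]; last first.
  have -> : p ^+ I.+1 = p ^+ (I.+1 - r) * p ^+ r by rewrite -exprD subnK // -ltnS.
  by move: (t _ _) (p ^+ _) (p ^+ _) => x y z; ring.
rewrite big_split /= [X in X + _ = _]big_ord_recr [X in _ + X = _]big_ord_recl /=.
rewrite subnn expr0 subrr mul0r addr0.
rewrite mulr0 mul0r add0r -big_split /=; apply: eq_bigr => r _.
rewrite /bump /= add1n /t subSS.
have rI : (r <= I)%N by rewrite -ltnS.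
(* At r = K the second piece has index K + 1 and is 0 by the default value in [t]. *)
have [rK|] := ltnP r K; last first.
  rewrite leq_eqVlt => /orP[/eqP -> | Kr].
    by rewrite leqnn subnn !muln0 subSn // qpochS -exprS mulr0 addr0; field; rewrite !qn q1n.
  by rewrite ifF ?ifF ?mulr0 ?addr0 //; apply/negbTE; rewrite -ltnNge // ltnW.
rewrite (ltnW rK) subSn //.
have [k kE] : exists k, (K - r = k.+1)%N by exists (K - r).-1; lia.
have -> : (K - r.+1 = k)%N by lia.
rewrite kE !qpochS -!exprS mulSn exprD mulnS exprD; field.
by rewrite !qn !q1n.
Qed.

End DurfeeRectangle.

Section NahmReduction.
Variable R : realType.
Local Notation C := (R[i] : numFieldType).
Variable q : C.
Hypotheses (q0 : q != 0) (q1 : `|q| < 1).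

Local Notation p := (q ^+ 4).

Lemma expf4_neq0 : p != 0. Proof. by rewrite expf_neq0. Qed.
Lemma normrX4_lt1 : `|p| < 1. Proof. by rewrite normrX exprn_ilt1. Qed.
Let p0 := expf4_neq0.
Let p1 := normrX4_lt1.

Let qn n : qpoch p p n != 0.
Proof. exact: qpoch_self_neq0. Qed.

Lemma norm_expz_le (e : int) (n K : nat) : n%:Z <= e + K%:Z ->
  `|q ^ e| <= `|q| ^- K * `|q| ^+ n.
Proof.
move=> h; have -> : e = Posz n + Posz (absz (e + K%:Z - n%:Z)%R) - Posz K by lia.
rewrite !expfzDr // -invr_expz -!exprnP !normrM normfV !normrX mulrC.
rewrite ler_wpM2l ?invr_ge0 ?exprn_ge0 // ler_piMr ?exprn_ge0 //.
by rewrite exprn_ile1 // ltW.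
Qed.

(* Inserting [durfee_rectangle] for the indices [I = i + r] and [K = k + r] of
   the Nahm sum adds [4 i k] to the exponent, which removes the cross term
   between [i] and [k]. *)
Definition durfee_nahm_term (b1 b2 b3 : int) (x : (nat * nat) * (nat * nat)) : C :=
  let: ((j, k), (i, r)) := x in
  q ^ (2 * (i%:Z - j%:Z) ^+ 2 + (j%:Z + 2 * k%:Z) ^+ 2 + 2 * r%:Z ^+ 2 + 4 * k%:Z * r%:Z
       + b1 * (i%:Z + r%:Z) + b2 * j%:Z + b3 * (k%:Z + r%:Z))
  / (qpoch p p i * qpoch p p j * qpoch p p k * qpoch p p r).

Lemma abs_summable_durfee_nahm_term (b1 b2 b3 : int) :
  -2 <= b1 -> -2 <= b2 -> 0 <= b3 -> abs_summable (durfee_nahm_term b1 b2 b3).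
Proof.
move=> hb1 hb2 hb3; have [K K0 hK] := qpochV_bounded p0 p1.
have h1 := abs_summable_geom q1; have h2 := abs_summable_tensor h1 h1.
have h4 := abs_summable_tensor h2 h2.
(* With u = i - j and the extreme coefficients, the exponent minus i + j + k + r is at least (2 u^2
   - 3 u) + (j^2 - 6 j) + (4 k^2 - k) + (2 r^2 - 3 r) >= - 13, so 20 is ample. *)
have [N N20] : exists N, N = 20%N by exists 20%N.
apply: abs_summable_le h4 (_ : 0 <= K * K * K * K * `|q| ^- N) _.
  by rewrite !mulr_ge0 ?invr_ge0 ?exprn_ge0 // ltW.
case=> -[j k] [i r] /=.
rewrite normrM mulrC -[leRHS]mulrA; apply: ler_pM => //.
  rewrite !invfM !normrM -!mulrA; do 3![apply: ler_pM; rewrite ?mulr_ge0 ?hK //].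
rewrite !normrM !normrX -!exprD; apply: norm_expz_le.
have u2 : 0 <= 2 * (i%:Z - j%:Z) ^+ 2 - 3 * (i%:Z - j%:Z) + 2 by nia.
have j2 : 0 <= (j%:Z - 3) ^+ 2 by rewrite sqr_ge0.
have e1 : 0 <= (b1 + 2) * (i%:Z + r%:Z) by apply: mulr_ge0; lia.
have e2 : 0 <= (b2 + 2) * j%:Z by apply: mulr_ge0; lia.
have e3 : 0 <= b3 * (k%:Z + r%:Z) by apply: mulr_ge0; lia.
have e4 : 0 <= j%:Z * k%:Z by apply: mulr_ge0; lia.
have e5 : 0 <= k%:Z * r%:Z by apply: mulr_ge0; lia.
have e6 : 0 <= 4 * k%:Z ^+ 2 - k%:Z by nia.
have e7 : 0 <= 2 * r%:Z ^+ 2 - 3 * r%:Z + 2 by nia.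
rewrite !expr2 in u2 j2 e6 e7 *; lia.
Qed.

(** The fibre over a triple (i, j, k) is finite, since r is at most min(i, k), and it sums to the
    Nahm term by the rectangle identity. So the triple series inherits convergence from the fourfold
    one. *)
Lemma nahm_sum_of_durfee (b1 b2 b3 : int) (l : C) :
  has_sum (durfee_nahm_term b1 b2 b3) l -> has_sum (nahm_term q b1 b2 b3) l.
Proof.
move=> /(@has_sum_fibre_seq _ _ _
  (fun x : (nat * nat) * (nat * nat) => (x.2.1 + x.2.2, x.1.1, x.1.2 + x.2.2)%N)
  (fun t : nat * nat * nat => [seq ((t.1.2, t.2 - r), (t.1.1 - r, r))%N
    | r <- iota 0 t.1.1.+1 & (r <= t.2)%N])) h.
apply: eq_has_sum (h _ _) => [[[i j] k]|[[i j] k]|[[i j] k] [[j' k'] [i' r']]].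
- rewrite big_map big_filter -[iota 0 i.+1]/(index_iota 0 i.+1) big_mkord.
  rewrite /nahm_term (mulrAC (qpoch p p i)) invfM mulrA -durfee_rectangle //.
  rewrite mulr_sumr mulr_suml; apply: eq_bigr => r rk.
  have ri : (r <= i)%N by rewrite -ltnS.
  rewrite -exprM (_ : q ^+ _ = q ^ Posz (4 * ((i - r) * (k - r)))) // mulrA -expfzDr // -!mulrA -!invfM.
  congr (q ^ _ * _^-1); last by ring.
  by rewrite /quad_exp !PoszM -!subzn // ; ring.
- by rewrite map_inj_uniq ?filter_uniq ?iota_uniq // => a b [].
apply/mapP/eqP => [[r]|[<- <- <-]].
  by rewrite mem_filter mem_iota /= => hr [-> -> -> ->] /=; congr (_, _, _); lia.
exists r'; first by rewrite mem_filter mem_iota /=; lia.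
by congr (_, _, (_, _)) => /=; lia.
Qed.

(* With [qpoch_inf_split], this evaluates [(- x p^(-j); p)_inf]. *)
Lemma qpoch_reverse (x : C) (j : nat) : x != 0 ->
  q ^+ (2 * j * j) * qpoch (- (x * q ^ (- (4 * j)%:Z))) p j =
  (x * q ^ (- 2)) ^+ j * qpoch (- (p / x)) p j.
Proof.
move=> x0; elim: j => [|j IH]; first by rewrite !qpoch0 muln0 !expr0.
rewrite qpochSl [in RHS]qpochS.
rewrite (_ : - (x * q ^ (- (4 * j.+1)%:Z)) * p = - (x * q ^ (- (4 * j)%:Z))); last first.
  have pE : p = q ^ 4 by [].
  rewrite mulNr -mulrA pE -expfzDr //; congr (- (x * q ^ _)); lia.
rewrite (_ : (2 * j.+1 * j.+1 = 2 * j * j + (4 * j + 2))%N); last by lia.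
rewrite exprD [in RHS]exprS mulrACA -[LHS]mulrA [X in _ * X](_ : _ =
   (x * q ^ (-2) * (1 - - (p / x) * p ^+ j)) * qpoch (- (x * q ^ (- (4 * j)%:Z))) p j).
  by rewrite mulrCA IH; ring.
rewrite mulrA; congr (_ * _).
have -> : q ^ (- (4 * j.+1)%:Z) = (p ^+ j * p)^-1 by rewrite -exprSr -exprM -invr_expz.
have -> : q ^ (-2) = (q ^+ 2)^-1 by [].
rewrite exprD exprM; have : p ^+ j != 0 by rewrite expf_neq0.
by move: (p ^+ j) => z z0; field; rewrite x0 q0 z0.
Qed.

Definition nahm_left (b1 b2 : int) (j : nat) : C :=
  q ^ ((b1 + b2) * j%:Z) * qpoch (- q ^ (2 - b1)) p j / qpoch p p j.

Definition nahm_right (b1 b3 : int) (k : nat) : C :=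
  q ^ (b3 * k%:Z) / (qpoch p p k * qpoch (- q ^ (2 + b1 + b3)) p k).

(** For fixed (j, k) the sums over i and r are Euler series with arguments q^(2 + b1 - 4 j) and q^(2
    + b1 + b3 + 4 k), because p^C(i, 2) = q^(2 i^2 - 2 i). Reversing the first j factors of the
    first product uses up q^(2 j^2), and q^((j + 2 k)^2) remains. Positivity of 2 + b1 + b3 puts
    q^(2 + b1 + b3) in the unit disc, so the symbol in the denominator of [nahm_right] is
    nonzero. *)
Lemma nahm_reduction (b1 b2 b3 : int) (m : C) :
  -2 <= b1 -> -2 <= b2 -> 0 <= b3 -> 0 < 2 + b1 + b3 ->
  has_sum (fun n => q ^+ (n * n) *
    \sum_(k < n./2.+1) nahm_left b1 b2 (n - k.*2) * nahm_right b1 b3 k) m ->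
  nahm_sum_is q b1 b2 b3
    (qpoch_inf (- q ^ (2 + b1)) p * qpoch_inf (- q ^ (2 + b1 + b3)) p * m).
Proof.
move=> hb1 hb2 hb3 hb hm.
set P1 := qpoch_inf _ p; set P2 := qpoch_inf _ p.
have [l hl] := abs_summable_has_sum (abs_summable_durfee_nahm_term hb1 hb2 hb3).
suff <- : l = P1 * P2 * m by case: (nahm_sum_of_durfee hl).
have xz1 : `|- q ^ (2 + b1 + b3)| < 1.
  case: (2 + b1 + b3) hb => // -[//|n] _.
  by rewrite normrN -exprnP normrX exprn_ilt1.
pose g (jk : nat * nat) := P1 * P2 * (q ^+ ((jk.1 + jk.2.*2) * (jk.1 + jk.2.*2)) *
   (nahm_left b1 b2 jk.1 * nahm_right b1 b3 jk.2)).
have hg : has_sum g l.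
  apply: has_sum_prod hl _ => -[j k] /=.
  have e1 := has_sum_euler p0 p1 (q ^ (2 + b1) * q ^ (- (4 * j)%:Z)).
  have e2 := has_sum_euler p0 p1 (q ^ (2 + b1 + b3) * p ^+ k).
  have [l' hl'] := abs_summable_has_sum (abs_summable_tensor
    (abs_summable_euler p0 p1 (q ^ (2 + b1) * q ^ (- (4 * j)%:Z)))
    (abs_summable_euler p0 p1 (q ^ (2 + b1 + b3) * p ^+ k))).
  have l'E := has_sum_tensor e1 e2 hl'.
  pose c := q ^ ((j%:Z + 2 * k%:Z) ^+ 2 + b2 * j%:Z + b3 * k%:Z + 2 * j%:Z * j%:Z)
    / (qpoch p p j * qpoch p p k).
  have -> : g (j, k) = c * l'.
    have x0 : q ^ (2 + b1) != 0 by rewrite expfz_neq0.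
    have := qpoch_inf_split p0 p1 (- (q ^ (2 + b1) * q ^ (- (4 * j)%:Z))) j.
    rewrite (_ : - (q ^ (2 + b1) * q ^ (- (4 * j)%:Z)) * p ^+ j = - q ^ (2 + b1)); last first.
      rewrite -mulNr -mulrA -exprM (_ : q ^+ (4 * j) = q ^ Posz (4 * j)) // -expfzDr //.
      by rewrite addNr expr0z mulr1.
    have := qpoch_inf_split p0 p1 (- q ^ (2 + b1 + b3)) k; rewrite mulNr l'E => E2 ->.
    have y0 : qpoch (- q ^ (2 + b1 + b3)) p k != 0 by exact: qpoch_neq0.
    rewrite -/P1 /g /c /nahm_left /nahm_right /= /P2 E2.
    have := qpoch_reverse j x0; rewrite -!expfzDr //.
    rewrite (_ : p / q ^ (2 + b1) = q ^ (2 - b1)); last first.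
      rewrite (_ : p = q ^ 4) // invr_expz -expfzDr //; congr (q ^ _); ring.
    rewrite [_ ^+ j]exprnP exprz_exp (_ : (2 + b1 - 2) * Posz j = b1 * Posz j); last by ring.
    rewrite (_ : _ + 2 * j%:Z * j%:Z = Posz ((j + k.*2) * (j + k.*2)) + b2 * j%:Z
      + b3 * k%:Z + Posz (2 * j * j)); last by rewrite -muln2 !PoszM !PoszD !PoszM; ring.
    rewrite mulrDl [q ^ (b1 * _ + _)]expfzDr // [q ^ (_ + Posz (2 * j * j))]expfzDr //.
    rewrite [q ^ (_ + b3 * _)]expfzDr // [q ^ (_ + b2 * _)]expfzDr // -!exprnP.
    have X0 : q ^+ (2 * j * j) != 0 by rewrite expf_neq0.
    move=> /(canRL (mulKf X0)) ->.
    move: y0; move: (qpoch (- q ^ (2 + b1 + b3)) p k) => y y0.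
    by field; rewrite !qn y0 X0.
  apply: eq_has_sum (has_sumZ c hl') => -[i r] /=.
  rewrite /c /euler_term.
  have bin4 n : p ^+ 'C(n, 2) = q ^ (2 * n%:Z ^+ 2 - 2 * n%:Z).
    rewrite -exprM exprnP; congr (q ^ _).
    by have := bin2_double n; case: n => //= n; nia.
  rewrite !bin4 -!expfzDr // -exprM [q ^+ (4 * k)]exprnP -expfzDr // ![_ ^+ i]exprnP ![_ ^+ r]exprnP !exprz_exp.
  rewrite [LHS](_ : _ = q ^ ((j%:Z + 2 * k%:Z) ^+ 2 + b2 * j%:Z + b3 * k%:Z + 2 * j%:Z * j%:Z)
    * q ^ (2 * i%:Z ^+ 2 - 2 * i%:Z) * q ^ ((2 + b1 - (4 * j)%:Z) * i%:Z)
    * q ^ (2 * r%:Z ^+ 2 - 2 * r%:Z) * q ^ ((2 + b1 + b3 + (4 * k)%:Z) * r%:Z)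
    / (qpoch p p i * qpoch p p j * qpoch p p k * qpoch p p r)); last first.
    move: (qn i) (qn j) (qn k) (qn r).
    move: (q ^ _) (q ^ _) (q ^ _) (q ^ _) (q ^ _) => x1 x2 x3 x4 x5 n1 n2 n3 n4.
    by field; rewrite n1 n2 n3 n4.
  by rewrite -!expfzDr //; congr (q ^ _ / _); rewrite !PoszM; ring.
have := has_sum_antidiagonal2 hg.
move=> h; apply: has_sum_unique h _.
apply: eq_has_sum (has_sumZ (P1 * P2) hm) => n; rewrite !mulr_sumr; apply: eq_bigr => k _.
rewrite /g /=; congr (_ * (q ^+ _ * _)); have := ltn_ord k; rewrite ltnS => hk.
by have -> : (n - k.*2 + k.*2 = n)%N by lia.
Qed.

End NahmReduction.

Section NahmTheta.
Variable R : realType.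
Local Notation C := (R[i] : numFieldType).
Variable q : C.
Hypotheses (q0 : q != 0) (q1 : `|q| < 1).

Local Notation p := (q ^+ 4).
Let p0 := expf4_neq0 q0.
Let p1 := normrX4_lt1 q1.
Let qn n : qpoch p p n != 0.
Proof. exact: qpoch_self_neq0. Qed.

(** On the diagonal a - b = d >= 0 one has (a + b)^2 = d^2 + 4 (b^2 + b d), which leaves q^(d^2)
    times a Durfee series in p; negative d are symmetric. The growth allowed for [c] admits the
    weight q^(- 2 d). *)
Lemma has_sum_pair_sum (c : int -> C) (theta K : C) :
  (forall d, `|c d * q ^+ (2 * absz d)| <= K) ->
  has_sum (fun d => c d * q ^ (d * d)) theta ->
  has_sum (fun n => q ^+ (n * n) * pair_sum p c n) (theta / qpoch_inf p p).
Proof.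
move=> hc htheta; have [Kp Kp0 hKp] := qpochV_bounded p0 p1.
have K0 : 0 <= K by apply: le_trans (hc 0).
pose f (x : nat * nat) := q ^+ ((x.1 + x.2) * (x.1 + x.2)) *
  (c (x.1%:Z - x.2%:Z) / (qpoch p p x.1 * qpoch p p x.2)).
have [l hl] : exists l, has_sum f l.
  apply: abs_summable_has_sum.
  have h1 := abs_summable_geom q1; have h2 := abs_summable_tensor h1 h1.
  (* With s = a + b >= |a - b|, the exponent s^2 - 2 |a - b| is at least s^2 - 2 s >= s - 3. *)
  have [N N3] : exists N, N = 3%N by exists 3%N.
  apply: abs_summable_le h2 (_ : 0 <= K * (Kp * Kp) * `|q| ^- N) _.
    by rewrite !mulr_ge0 ?invr_ge0 ?exprn_ge0 // ltW.
  case=> a b; rewrite /f /=.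
  rewrite (_ : q ^+ _ * _ = (c (a%:Z - b%:Z) * q ^+ (2 * absz (a%:Z - b%:Z)%R)) *
    ((qpoch p p a)^-1 * (qpoch p p b)^-1) *
    q ^ (Posz ((a + b) * (a + b)) - Posz (2 * absz (a%:Z - b%:Z)%R))); last first.
    rewrite expfzDr // -invr_expz -!exprnP.
    by field; rewrite !qn expf_neq0.
  rewrite normrM -[leRHS]mulrA; apply: ler_pM => //.
    by rewrite normrM; apply: ler_pM => //; rewrite normrM ler_pM.
  rewrite !normrM !normrX -!exprD; apply: norm_expz_le => //; rewrite N3.
  have : (absz (a%:Z - b%:Z)%R <= a + b)%N by lia.
  move: (absz _) (a + b)%N => d s ds.
  have h3 : (s * 3 <= s * s + 3)%N by case: s {ds} => [|[|s]] //; nia.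
  lia.
have lE : l = theta / qpoch_inf p p.
  apply: has_sum_unique (_ : has_sum (fun d => (qpoch_inf p p)^-1 * (c d * q ^ (d * d))) _) _; last first.
    by rewrite mulrC; exact: has_sumZ.
  apply: has_sum_diagonals hl _ _ => n.
    rewrite mulrC; apply: eq_has_sum (has_sumZ _ (durfee_sum p0 p1 n)) => b.
    rewrite /f /durfee_term /= -exprM (_ : Posz (b + n) - Posz b = Posz n); last by lia.
    rewrite (_ : q ^ (n%:Z * n%:Z) = q ^+ (n * n)) //.
    rewrite (_ : ((b + n + b) * (b + n + b) = 4 * (b * b + b * n) + n * n)%N); last by nia.
    by rewrite exprD; field; rewrite !qn.
  rewrite mulrC; apply: eq_has_sum (has_sumZ _ (durfee_sum p0 p1 n.+1)) => b.
  rewrite /f /durfee_term /= -exprM (_ : Posz b - Posz (b + n.+1) = Negz n); last by lia.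
  rewrite (_ : q ^ (Negz n * Negz n) = q ^+ (n.+1 * n.+1)); last by rewrite exprnP; congr (q ^ _); nia.
  rewrite (_ : ((b + (b + n.+1)) * (b + (b + n.+1)) = 4 * (b * b + b * n.+1) + n.+1 * n.+1)%N); last by nia.
  by rewrite exprD; field; rewrite !qn.
rewrite -lE; apply: eq_has_sum (has_sum_antidiagonal hl) => n.
rewrite /pair_sum mulr_sumr; apply: eq_bigr => k _.
by rewrite /f /= subnK // -ltnS.
Qed.

End NahmTheta.

(** * Coefficient identities from q-difference equations *)

(* Sequences are read as coefficients of formal power series in [x]: [conv] is
   the product, [shiftx u] is [x u(x)], and [dil p u] is [u(p x)]. *)
Section PowerSeries.
Variable C : numFieldType.
Implicit Types (u v a c : nat -> C).

Definition conv u v (n : nat) : C := \sum_(k < n.+1) u (n - k)%N * v k.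
Definition shiftx u (n : nat) : C := if n is m.+1 then u m else 0.
Definition dil (p : C) u (n : nat) : C := p ^+ n * u n.

Lemma conv_shiftl u v : conv (shiftx u) v = shiftx (conv u v).
Proof.
apply/funext => -[|n]; first by rewrite /conv big_ord_recl big_ord0 /= mul0r addr0.
rewrite /conv big_ord_recr /= subnn mul0r addr0; apply: eq_bigr => k _.
by rewrite subSn // -ltnS.
Qed.

Lemma conv_shiftr u v : conv u (shiftx v) = shiftx (conv u v).
Proof.
apply/funext => -[|n]; first by rewrite /conv big_ord_recl big_ord0 /= mulr0 addr0.
by rewrite /conv big_ord_recl /= mulr0 add0r; apply: eq_bigr.
Qed.

Lemma conv_dil p u v : conv (dil p u) (dil p v) = dil p (conv u v).
Proof.
apply/funext => n.
rewrite /conv /dil mulr_sumr; apply: eq_bigr => k _.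
by rewrite mulrACA -exprD subnK // -ltnS.
Qed.

Lemma convDl u u' v n : conv (fun k => u k + u' k) v n = conv u v n + conv u' v n.
Proof. by rewrite /conv -big_split; apply: eq_bigr => k _; rewrite mulrDl. Qed.

Lemma convZl x u v n : conv (fun k => x * u k) v n = x * conv u v n.
Proof. by rewrite /conv mulr_sumr; apply: eq_bigr => k _; rewrite mulrA. Qed.

Lemma convDr u v v' n : conv u (fun k => v k + v' k) n = conv u v n + conv u v' n.
Proof. by rewrite /conv -big_split; apply: eq_bigr => k _; rewrite mulrDr. Qed.

Lemma convZr x u v n : conv u (fun k => x * v k) n = x * conv u v n.
Proof. by rewrite /conv mulr_sumr; apply: eq_bigr => k _; rewrite mulrCA. Qed.

Lemma eq_conv u u' v v' n : u =1 u' -> v =1 v' -> conv u v n = conv u' v' n.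
Proof. by move=> hu hv; apply: eq_bigr => k _; rewrite hu hv. Qed.

(* [(1 - d x) (1 - l1 x - l2 x^2) w(x) = (1 + k x) w(p x)] *)
Definition qrec (p d l1 l2 k : C) (w : nat -> C) : Prop := forall n,
  w n - (d + l1) * shiftx w n + (d * l1 - l2) * shiftx (shiftx w) n
    + d * l2 * shiftx (shiftx (shiftx w)) n
  = dil p w n + k * shiftx (dil p w) n.

Lemma qrec_conv p d l1 l2 k a c :
  (forall n, a n - d * shiftx a n = dil p a n + k * shiftx (dil p a) n) ->
  (forall n, c n - l1 * shiftx c n - l2 * shiftx (shiftx c) n = dil p c n) ->
  qrec p d l1 l2 k (conv a c).
Proof.
move=> ha hc n.
have := @eq_conv _ _ _ _ n ha hc.
pose a' n := a n + - d * shiftx a n.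
pose c' n := c n + - l1 * shiftx c n + - l2 * shiftx (shiftx c) n.
have -> : conv (fun n => a n - d * shiftx a n)
    (fun n => c n - l1 * shiftx c n - l2 * shiftx (shiftx c) n) n = conv a' c' n.
  by apply: eq_conv => m; rewrite /a' /c' !mulNr.
rewrite /a' /c' convDl convZl !convDr !convZr convDl convZl.
rewrite !conv_shiftl !conv_shiftr conv_dil => <-.
by ring.
Qed.

(** The equation expresses (1 - p^n) w n through earlier values, and 1 - p^n is nonzero for n >
    0. *)
Lemma qrec_unique p d l1 l2 k w w' : `|p| < 1 -> qrec p d l1 l2 k w ->
  qrec p d l1 l2 k w' -> w 0%N = w' 0%N -> w =1 w'.
Proof.
move=> p1 hw hw' h0 n.
have q1n m : 1 - p ^+ m.+1 != 0 by apply: subr1_neq0; rewrite normrX exprn_ilt1.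
elim/ltn_ind: n => -[//|n] IH; apply: (mulfI (q1n n)).
have e := hw n.+1; have e' := hw' n.+1.
have s1 : shiftx w n.+1 = shiftx w' n.+1 by rewrite /= IH.
have s2 : shiftx (shiftx w) n.+1 = shiftx (shiftx w') n.+1.
  by case: n IH {e e' s1} => //= n IH; rewrite IH // ltnW.
have s3 : shiftx (shiftx (shiftx w)) n.+1 = shiftx (shiftx (shiftx w')) n.+1.
  by case: n IH {e e' s1 s2} => //= -[|n] //= IH; rewrite IH // ltnW // ltnW.
have s4 : shiftx (dil p w) n.+1 = shiftx (dil p w') n.+1 by rewrite /= /dil IH.
rewrite s1 s2 s3 s4 in e; rewrite !mulrBl !mul1r -/(dil p w n.+1) -/(dil p w' n.+1).
move: e e'; set x := shiftx w' _; set y := shiftx (shiftx w') _.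
set z := shiftx (shiftx (shiftx w')) _; set t := shiftx (dil p w') _ => e e'.
suff h : w n.+1 - dil p w n.+1 - (w' n.+1 - dil p w' n.+1) = 0 by apply/eqP; rewrite -subr_eq0 h.
transitivity ((w n.+1 - (d + l1) * x + (d * l1 - l2) * y + d * l2 * z - dil p w n.+1 - k * t)
  - (w' n.+1 - (d + l1) * x + (d * l1 - l2) * y + d * l2 * z - dil p w' n.+1 - k * t)); first by ring.
by rewrite e e'; ring.
Qed.

End PowerSeries.

Section PairSums.
Variable C : numFieldType.
Variable p : C.
Hypothesis p1 : `|p| < 1.

Let qn n : qpoch p p n != 0.
Proof. exact: qpoch_neq0. Qed.

Let q1n n : 1 - p ^+ n.+1 != 0.
Proof. by apply: subr1_neq0; rewrite normrX exprn_ilt1. Qed.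

Definition pair_sum2 (f : nat -> nat -> C) (n : nat) : C :=
  \sum_(k < n.+1) f (n - k)%N k / (qpoch p p (n - k) * qpoch p p k).

Lemma pair_sum2_sym f n : pair_sum2 f n = pair_sum2 (fun a b => f b a) n.
Proof.
rewrite /pair_sum2 (reindex_inj rev_ord_inj); apply: eq_bigr => k _ /=.
have kn : (k <= n)%N by rewrite -ltnS.
by rewrite subSS subKn // [X in _ / X]mulrC.
Qed.

(** 1 - p^a cancels the last factor of (p)_a, so it lowers a by one. *)
Lemma pair_sum2_shift f n :
  pair_sum2 (fun a b => (1 - p ^+ a) * f a b) n = shiftx (pair_sum2 (fun a b => f a.+1 b)) n.
Proof.
case: n => [|n]; first by rewrite /pair_sum2 big_ord_recl big_ord0 /= expr0 subrr !mul0r addr0.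
rewrite /pair_sum2 big_ord_recr /= subnn expr0 subrr !mul0r addr0; apply: eq_bigr => k _.
have kn : (k <= n)%N by rewrite -ltnS.
by rewrite subSn // qpochS -exprS; field; rewrite !qn q1n.
Qed.

Lemma eq_pair_sum2 f g n : (forall a b, f a b = g a b) -> pair_sum2 f n = pair_sum2 g n.
Proof. by move=> h; apply: eq_bigr => k _; rewrite h. Qed.

Lemma pair_sum2B f g n :
  pair_sum2 f n - pair_sum2 g n = pair_sum2 (fun a b => f a b - g a b) n.
Proof. by rewrite /pair_sum2 -sumrB; apply: eq_bigr => k _; rewrite mulrBl. Qed.

Lemma dil_pair_sum2 (s : C) f n :
  dil s (pair_sum2 f) n = pair_sum2 (fun a b => s ^+ (a + b) * f a b) n.
Proof.
rewrite /dil /pair_sum2 mulr_sumr; apply: eq_bigr => k _.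
by rewrite subnK ?mulrA // -ltnS.
Qed.

(* With [d = a - b]: exponents [d^2] (square) and [d^2 - d] (pronic). *)
Definition square_pair_sum (s : C) := pair_sum2 (fun a b => s ^ ((a%:Z - b%:Z) * (a%:Z - b%:Z))).
Definition pronic_pair_sum (s : C) :=
  pair_sum2 (fun a b => s ^ ((a%:Z - b%:Z) * (a%:Z - b%:Z) - (a%:Z - b%:Z))).

Section QuadraticWeights.
Variable s : C.
Hypotheses (s0 : s != 0) (sp : s ^+ 2 = p).

Let expp n : p ^+ n = s ^ (2 * n%:Z).
Proof. by rewrite -sp -exprM exprnP PoszM. Qed.

(** Let E and O be the square and pronic generating functions, d = a - b. In E(s x) the exponent is
    d^2 + a + b = (d^2 - d) + 2 a, so O(x) - E(s x) carries the factor 1 - p^a; lowering a turns d^2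
    - d into d^2 + d, the pronic weight with a and b exchanged. *)
Lemma pronic_pair_sum_rec n :
  pronic_pair_sum s n - shiftx (pronic_pair_sum s) n = dil s (square_pair_sum s) n.
Proof.
apply/eqP; rewrite subr_eq addrC -subr_eq dil_pair_sum2 pair_sum2B.
rewrite (@eq_pair_sum2 _ (fun a b => (1 - p ^+ a) * s ^ ((a%:Z - b%:Z) * (a%:Z - b%:Z) - (a%:Z - b%:Z)))).
  rewrite pair_sum2_shift; case: n => [|n] //=.
  rewrite [pair_sum2 _ _]pair_sum2_sym; apply/eqP/eq_pair_sum2 => a b.
  by congr (s ^ _); lia.
move=> a b; rewrite [RHS]mulrBl mul1r expp exprnP -!expfzDr //; congr (_ - s ^ _); lia.
Qed.

(** With [h] the sum weighted by (d + 1)^2, two applications of the same trick give E(x) - O(s x) =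
    x h(x) and h(x) - s O(s x) = x E(x); then [h] is eliminated. *)
Lemma square_pair_sum_rec n :
  square_pair_sum s n - shiftx (shiftx (square_pair_sum s)) n =
  dil s (pronic_pair_sum s) n + s * shiftx (dil s (pronic_pair_sum s)) n.
Proof.
pose h := pair_sum2 (fun a b => s ^ ((a%:Z - b%:Z + 1) * (a%:Z - b%:Z + 1))).
have e1 m : square_pair_sum s m - dil s (pronic_pair_sum s) m = shiftx h m.
  rewrite dil_pair_sum2 pair_sum2B pair_sum2_sym.
  rewrite (@eq_pair_sum2 _ (fun a b => (1 - p ^+ a) * s ^ ((a%:Z - b%:Z) * (a%:Z - b%:Z)))).
    rewrite pair_sum2_shift; case: m => [|m] //=; apply: eq_pair_sum2 => a b.
    by congr (s ^ _); lia.
  move=> a b; rewrite [RHS]mulrBl mul1r expp exprnP -!expfzDr //; congr (s ^ _ - s ^ _); lia.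
have e2 m : h m - s * dil s (pronic_pair_sum s) m = shiftx (square_pair_sum s) m.
  rewrite (_ : s * _ = pair_sum2 (fun a b => s ^ (1 + (a + b)%N%:Z + (a%:Z - b%:Z) * (a%:Z - b%:Z) + (a%:Z - b%:Z))) m).
    rewrite pair_sum2B pair_sum2_sym.
    rewrite (@eq_pair_sum2 _ (fun a b => (1 - p ^+ a) * s ^ ((a%:Z - b%:Z - 1) * (a%:Z - b%:Z - 1)))).
      rewrite pair_sum2_shift; case: m => [|m] //=; apply: eq_pair_sum2 => a b.
      by congr (s ^ _); lia.
    move=> a b; rewrite [RHS]mulrBl mul1r expp -!expfzDr //; congr (s ^ _ - s ^ _); lia.
  rewrite dil_pair_sum2 [X in s * X]pair_sum2_sym /pair_sum2 mulr_sumr; apply: eq_bigr => k _.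
  rewrite mulrA; congr (_ / _); rewrite exprnP -{1}[s]expr1z -!expfzDr //; congr (s ^ _); lia.
have := e1 n; case: n => [|n] /=.
  by rewrite subr0 mulr0 addr0 => /eqP; rewrite subr_eq0 => /eqP ->.
by have := e2 n => /= <- /eqP; rewrite subr_eq => /eqP ->; ring.
Qed.

Lemma shiftx_dil u n : shiftx (dil s u) n * s = dil s (shiftx u) n.
Proof. by case: n => [|n]; rewrite /dil /= ?mulr0 ?mul0r // exprSr mulrAC. Qed.

(** O(s x) is eliminated between E(p x) = (1 - s x) O(s x) and (1 - x^2) E(x) = (1 + s x) O(s x). *)
Lemma square_pair_sum_qrec : qrec p s 0 1 s (square_pair_sum s).
Proof.
move=> n; set E := square_pair_sum s; set Z := dil s (pronic_pair_sum s).
have h1 m : dil p E m = Z m - s * shiftx Z m.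
  rewrite mulrC shiftx_dil /Z /dil -mulrBr pronic_pair_sum_rec /dil mulrA -sp -exprM mulnC.
  by rewrite mulnC mul2n -addnn exprD.
have h2 m : E m - shiftx (shiftx E) m = Z m + s * shiftx Z m by exact: square_pair_sum_rec.
have h1' : shiftx (dil p E) n = shiftx Z n - s * shiftx (shiftx Z) n.
  by case: n => [|n] /=; rewrite ?h1 // mulr0 subr0.
have h2' : shiftx E n - shiftx (shiftx (shiftx E)) n = shiftx Z n + s * shiftx (shiftx Z) n.
  by case: n {h1'} => [|n] /=; rewrite ?h2 // mulr0 addr0 subr0.
rewrite h1 h1'; transitivity ((E n - shiftx (shiftx E) n)
  - s * (shiftx E n - shiftx (shiftx (shiftx E)) n)); first by ring.
by rewrite h2 h2'; ring.
Qed.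

(** E(s x) is eliminated between (1 - x) O(x) = E(s x) and (1 - p x^2) E(s x) = (1 + p x) O(p x). *)
Lemma pronic_pair_sum_qrec : qrec p 1 0 p p (pronic_pair_sum s).
Proof.
move=> n; set O := pronic_pair_sum s; pose Y := dil s (square_pair_sum s).
have h1 m : O m - shiftx O m = Y m by exact: pronic_pair_sum_rec.
have h2 m : Y m - p * shiftx (shiftx Y) m = dil p O m + p * shiftx (dil p O) m.
  have dd u k : dil s (dil s u) k = dil p u k by rewrite /dil mulrA -exprMn -expr2 sp.
  have -> : p * shiftx (shiftx Y) m = dil s (shiftx (shiftx (square_pair_sum s))) m.
    rewrite -shiftx_dil; case: m => [|m] /=; first by rewrite mulr0 mul0r.
    by rewrite -shiftx_dil -sp; ring.
  have -> : p * shiftx (dil p O) m = dil s (fun k => s * shiftx (dil s O) k) m.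
    case: m => [|m]; rewrite /dil /= ?mulr0 // exprS.
    by rewrite -sp -exprM mul2n -addnn exprD; ring.
  by rewrite -dd /Y /dil -mulrBr -mulrDr square_pair_sum_rec.
have h1' k : shiftx (fun m => O m - shiftx O m) k = shiftx Y k by case: k => //= k; exact: h1.
have h1'' k : shiftx (shiftx (fun m => O m - shiftx O m)) k = shiftx (shiftx Y) k.
  by case: k => //= k; exact: h1'.
rewrite -h2 -h1 -h1''; case: n => [|[|n]] /=; ring.
Qed.

End QuadraticWeights.

(** Both sides of (1 - a x) (1 - b x) u(x) = u(p x) are multiplied by 1 + k x; the free k serves to
    match an equation with extra factors. *)
Lemma qrec_mul (a b k : C) (u : nat -> C) :
  (forall n, u n - (a + b) * shiftx u n + a * b * shiftx (shiftx u) n = dil p u n) ->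
  qrec p a (b - k) (b * k) k u.
Proof.
move=> h n; rewrite -h.
have -> : shiftx (dil p u) n = shiftx (fun n => u n - (a + b) * shiftx u n + a * b * shiftx (shiftx u) n) n.
  by case: n => //= n; rewrite h.
case: n => [|n] /=; ring.
Qed.

End PairSums.

Section Upsample.
Variable C : numFieldType.

(** The coefficients of b(x^2); this turns the constraint j + 2 k = n into an ordinary
    convolution. *)
Definition upsample (b : nat -> C) (m : nat) : C := if odd m then 0 else b m./2.

Lemma conv_upsample (a b : nat -> C) n :
  \sum_(k < n./2.+1) a (n - k.*2)%N * b k = conv a (upsample b) n.
Proof.
rewrite /conv (bigID (fun k : 'I_n.+1 => odd k)) /=.
rewrite [X in _ = X + _]big1 ?add0r => [|k ok]; last by rewrite /upsample ok mulr0.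
pose h (k : 'I_n./2.+1) : 'I_n.+1 := inord k.*2.
pose h' (k : 'I_n.+1) : 'I_n./2.+1 := inord k./2.
have hE k : h k = k.*2 :> nat by rewrite inordK // ltnS; have := ltn_ord k; lia.
have h'E k : h' k = k./2 :> nat by rewrite inordK // ltnS; have := ltn_ord k; lia.
rewrite (reindex_onto h h') => [|k ok]; last by apply: val_inj; rewrite /= hE h'E; lia.
apply: eq_big => [k|k _]; last by rewrite hE /upsample odd_double doubleK.
by rewrite hE odd_double /=; apply/esym/eqP/val_inj; rewrite /= h'E hE doubleK.
Qed.

End Upsample.

Section Coefficients.
Variable C : numFieldType.
Variable p : C.
Hypothesis p1 : `|p| < 1.

Let qn n : qpoch p p n != 0.
Proof. exact: qpoch_neq0. Qed.

Let q1n n : 1 - p ^+ n.+1 != 0.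
Proof. by apply: subr1_neq0; rewrite normrX exprn_ilt1. Qed.

(** Coefficients of (- c d x; p)_inf / (d x; p)_inf, by the q-binomial theorem. *)
Definition left_seq (d c : C) (n : nat) : C := d ^+ n * qpoch (- c) p n / qpoch p p n.

Lemma left_seq_rec d c n : left_seq d c n - d * shiftx (left_seq d c) n =
  dil p (left_seq d c) n + c * d * shiftx (dil p (left_seq d c)) n.
Proof.
case: n => [|n]; rewrite /dil /left_seq /=; first by rewrite !expr0 !mulr0; ring.
by rewrite !qpochS -!exprS !exprS; field; rewrite qn -exprS q1n.
Qed.

(** As (p)_k (- p; p)_k = (p^2; p^2)_k, upsampling gives 1 / (e x^2; p^2)_inf. *)
Definition right_seq (e : C) (k : nat) : C := e ^+ k / (qpoch p p k * qpoch (- p) p k).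

Lemma right_seq_rec e n : upsample (right_seq e) n - 0 * shiftx (upsample (right_seq e)) n
  - e * shiftx (shiftx (upsample (right_seq e))) n = dil p (upsample (right_seq e)) n.
Proof.
rewrite mul0r subr0 /dil; case: n => [|[|n]] /=.
- by rewrite expr0 mul1r mulr0 subr0.
- by rewrite /upsample /= !mulr0 subr0.
rewrite /upsample /= negbK; case: ifP => on; first by rewrite !mulr0 subr0.
rewrite /right_seq !qpochS -!exprS (_ : p ^+ n.+2 = p ^+ n./2.+1 * p ^+ n./2.+1); last first.
  by rewrite -exprD; congr (_ ^+ _); lia.
have pn : 1 + p ^+ n./2.+1 != 0.
  by rewrite -[p ^+ _]opprK; apply: subr1_neq0; rewrite normrN normrX exprn_ilt1.
have qn' : qpoch (- p) p n./2 != 0 by apply: qpoch_neq0; rewrite ?normrN.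
rewrite mulNr -exprS opprK exprS; set x := p ^+ _.
by field; rewrite !qn qn' q1n pn.
Qed.

Lemma conv_left_right_qrec d c e :
  qrec p d 0 e (c * d) (conv (left_seq d c) (upsample (right_seq e))).
Proof. by apply: qrec_conv => n; [exact: left_seq_rec | exact: right_seq_rec]. Qed.

Lemma conv0 (u v : nat -> C) : conv u v 0 = u 0%N * v 0%N.
Proof. by rewrite /conv big_ord_recl big_ord0 addr0. Qed.

Definition geom_seq (d : C) (n : nat) : C := d ^+ n / qpoch p p n.

Lemma geom_seq_rec d n : geom_seq d n - d * shiftx (geom_seq d) n = dil p (geom_seq d) n.
Proof.
rewrite /dil /geom_seq; case: n => [|n] /=; first by rewrite expr0; ring.
by rewrite !qpochS -!exprS !exprS; field; rewrite qn -exprS q1n.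
Qed.

Lemma pair_sum2_geom (d g : C) : pair_sum2 p (fun a b => d ^+ a * g ^+ b) =
  conv (geom_seq d) (geom_seq g).
Proof.
apply/funext => n; apply: eq_bigr => k _; rewrite /geom_seq.
by rewrite invfM mulrACA.
Qed.

Lemma pair_sum2_geom_qrec (d g k : C) : qrec p d (g - k) (g * k) k
  (pair_sum2 p (fun a b => d ^+ a * g ^+ b)).
Proof.
rewrite pair_sum2_geom; apply: qrec_mul => n.
have h0 : qrec p d g 0 0 (conv (geom_seq d) (geom_seq g)).
  apply: qrec_conv => m; first by rewrite mul0r addr0 geom_seq_rec.
  by rewrite mul0r subr0 geom_seq_rec.
by have := h0 n; rewrite mul0r addr0 => <-; ring.
Qed.

(** In product form, (- g x; p)_inf cancels against (g^2 x^2; p^2)_inf and leaves 1 / ((d x; p)_inf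
    (g x; p)_inf). *)
Lemma conv_geom_pair_sum d g c n : c * d = g ->
  conv (left_seq d c) (upsample (right_seq (g ^+ 2))) n =
  pair_sum2 p (fun a b => d ^+ a * g ^+ b) n.
Proof.
move=> cd; apply: (qrec_unique p1 (conv_left_right_qrec _ _ _)).
  have := pair_sum2_geom_qrec d g g; rewrite subrr -expr2 cd; exact.
by rewrite conv0 pair_sum2_geom conv0 /left_seq /geom_seq /upsample /right_seq /= !expr0 !qpoch0; field.
Qed.

Lemma pair_sum2_0 (f : nat -> nat -> C) : f 0%N 0%N = 1 -> pair_sum2 p f 0 = 1.
Proof. by move=> f0; rewrite /pair_sum2 big_ord_recl big_ord0 /= f0 !qpoch0; field. Qed.

Lemma conv_left_right0 d c e : conv (left_seq d c) (upsample (right_seq e)) 0 = 1.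
Proof. by rewrite conv0 /left_seq /upsample /right_seq /= !expr0 !qpoch0; field. Qed.

Lemma conv_square_pair_sum (s : C) n : s != 0 -> s ^+ 2 = p ->
  conv (left_seq s 1) (upsample (right_seq 1)) n = square_pair_sum p s n.
Proof.
move=> s0 sp; apply: (qrec_unique p1 (conv_left_right_qrec _ _ _)).
  by rewrite mul1r; exact: square_pair_sum_qrec.
by rewrite conv_left_right0 /square_pair_sum pair_sum2_0.
Qed.

Lemma conv_pronic_pair_sum (s : C) n : s != 0 -> s ^+ 2 = p ->
  conv (left_seq 1 p) (upsample (right_seq p)) n = pronic_pair_sum p s n.
Proof.
move=> s0 sp; apply: (qrec_unique p1 (conv_left_right_qrec _ _ _)).
  by rewrite mulr1; exact: pronic_pair_sum_qrec.
by rewrite conv_left_right0 /pronic_pair_sum pair_sum2_0.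
Qed.

Section Half.
Variable t : C.
Hypotheses (t0 : t != 0) (tp : t ^+ 2 = p).

Lemma sqrt_lt1 : `|t| < 1.
Proof. by have := p1; rewrite -tp normrX expr_lte1. Qed.

Let tn n : qpoch t t n != 0.
Proof. by apply: qpoch_neq0; exact: sqrt_lt1. Qed.

(** Even powers of [t] make up (p; p)_k, odd ones (t; p)_k. *)
Lemma qpoch_sqrt_double k : qpoch t t k.*2 = qpoch p p k * qpoch t p k.
Proof.
elim: k => [|k IH]; first by rewrite !qpoch0 mulr1.
have e1 : p ^+ k = t ^+ k.*2 by rewrite -tp -exprM mul2n.
have e2 : p * p ^+ k = t ^+ k.*2.+2 by rewrite e1 -tp -exprD add2n.
by rewrite doubleS !qpochS IH e2 e1 !exprS; ring.
Qed.

Definition sqrt_seq (e : C) (m : nat) : C := e ^+ m / qpoch t t m.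

Lemma sqrt_seq_rec e n : sqrt_seq e n - e * shiftx (sqrt_seq e) n = dil t (sqrt_seq e) n.
Proof.
rewrite /dil /sqrt_seq; case: n => [|n] /=; first by rewrite expr0; ring.
have h := tn n.+1; rewrite qpochS mulf_eq0 negb_or -exprS in h.
case/andP: h => h1 h2.
by rewrite !qpochS -!exprS !exprS; field; rewrite h1 -exprS h2.
Qed.

(** The series is 1 / (e x; t)_inf. Replacing x by p x is dilating by [t] twice, which removes the
    factors 1 - e x and 1 - e t x. *)
Lemma sqrt_seq_rec2 e n : sqrt_seq e n - e * (1 + t) * shiftx (sqrt_seq e) n
  - (- (e ^+ 2 * t)) * shiftx (shiftx (sqrt_seq e)) n = dil p (sqrt_seq e) n.
Proof.
have h m : dil t (sqrt_seq e) m = sqrt_seq e m - e * shiftx (sqrt_seq e) m.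
  by rewrite sqrt_seq_rec.
have -> : dil p (sqrt_seq e) n = dil t (dil t (sqrt_seq e)) n.
  by rewrite /dil mulrA -exprMn -expr2 tp.
rewrite {1}/dil h mulrBr -/(dil t (sqrt_seq e) n) h.
case: n => [|n] /=; first by rewrite !mulr0; ring.
transitivity (sqrt_seq e n.+1 - e * sqrt_seq e n - e * t * dil t (sqrt_seq e) n).
  by rewrite h; ring.
by rewrite /dil exprS; ring.
Qed.

Lemma conv_half_qrec e : qrec p 1 (e * (1 + t)) (- (e ^+ 2 * t)) (- t)
  (conv (left_seq 1 (- t)) (sqrt_seq e)).
Proof.
apply: qrec_conv => n; last exact: sqrt_seq_rec2.
by rewrite left_seq_rec mulr1.
Qed.

Lemma conv_half0 e : conv (left_seq 1 (- t)) (sqrt_seq e) 0 = 1.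
Proof. by rewrite conv0 /left_seq /sqrt_seq !expr0 !qpoch0; field. Qed.

(** For e = 1 the equation is (1 - x)^2 (1 - t x) w(x) = (1 - t x) w(p x), that of 1 / (x; p)_inf^2
    multiplied by 1 - t x. *)
Lemma conv_half_pos n :
  conv (left_seq 1 (- t)) (sqrt_seq 1) n = pair_sum2 p (fun _ _ => 1) n.
Proof.
apply: (qrec_unique p1 (conv_half_qrec 1)); last by rewrite conv_half0 pair_sum2_0.
have := pair_sum2_geom_qrec 1 1 (- t).
rewrite (_ : (fun a b : nat => 1 ^+ a * 1 ^+ b) = (fun _ _ => 1)); last first.
  by apply/funext => a; apply/funext => b; rewrite !expr1n mulr1.
by rewrite !mul1r opprK expr1n mul1r.
Qed.

(** For e = - 1 the left polynomial is (1 - x) (1 + x) (1 + t x), the one of the square weights with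
    s = - t. *)
Lemma conv_half_neg n :
  conv (left_seq 1 (- t)) (sqrt_seq (-1)) n = square_pair_sum p (- t) n.
Proof.
apply: (qrec_unique p1 (conv_half_qrec (-1))); last by rewrite conv_half0 /square_pair_sum pair_sum2_0.
have h : qrec p (- t) 0 1 (- t) (square_pair_sum p (- t)).
  by apply: square_pair_sum_qrec => //; rewrite ?oppr_eq0 // sqrrN.
by move=> m; rewrite -h; ring.
Qed.

(** By [qpoch_sqrt_double] the upsampled sequence is the even part of 1 / (x; t)_inf, the average of
    [sqrt_seq 1] and [sqrt_seq (-1)]. *)
Lemma conv_half_even n :
  conv (left_seq 1 (- t)) (upsample (fun k => (qpoch p p k * qpoch t p k)^-1)) n =
  (pair_sum2 p (fun _ _ => 1) n + square_pair_sum p (- t) n) / 2.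
Proof.
rewrite -conv_half_pos -conv_half_neg mulrC -convDr -convZr.
apply: eq_conv => // m; rewrite /upsample /sqrt_seq expr1n.
case: ifP => om; first by rewrite -signr_odd om expr1; field.
rewrite -signr_odd om expr0 -qpoch_sqrt_double even_halfK ?om //.
by field.
Qed.

(** Now (p)_k (t; p)_(k + 1) = (t; t)_(2 k + 1) yields the odd part, which starts at x; hence the
    index [n.+1] on the right. *)
Lemma conv_half_odd n :
  conv (left_seq 1 (- t)) (upsample (fun k => (qpoch p p k * qpoch t p k.+1)^-1)) n =
  (pair_sum2 p (fun _ _ => 1) n.+1 - square_pair_sum p (- t) n.+1) / 2.
Proof.
rewrite -[LHS]/(shiftx (conv _ _) n.+1) -conv_shiftr.
rewrite -conv_half_pos -conv_half_neg mulrC -[- conv _ _ _]mulN1r -convZr -convDr -convZr.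
apply: eq_conv => // -[|m] /=; first by rewrite /sqrt_seq !expr0; field.
rewrite /upsample /sqrt_seq expr1n -signr_odd /=.
case: (boolP (odd m)) => om /=; first by rewrite expr0; field.
have e : qpoch t t m.+1 = qpoch p p m./2 * qpoch t p m./2.+1.
  rewrite [in RHS]qpochS mulrA -qpoch_sqrt_double even_halfK // qpochS; congr (_ * (1 - t * _)).
  by rewrite -tp -exprM mul2n even_halfK.
by rewrite -e expr1; field; rewrite tn.
Qed.

End Half.
End Coefficients.

(** * Theta series as products *)

Section ProductIdentities.
Variable R : realType.
Local Notation C := (R[i] : numFieldType).
Variable p : C.
Hypotheses (p0 : p != 0) (p1 : `|p| < 1).

Lemma qpoch_inf_sqr (a : C) :
  qpoch_inf a p * qpoch_inf (- a) p = qpoch_inf (a ^+ 2) (p ^+ 2).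
Proof.
have p20 : p ^+ 2 != 0 by rewrite expf_neq0.
have p21 : `|p ^+ 2| < 1 by rewrite normrX exprn_ilt1.
have h1 : qpoch a p n * qpoch (- a) p n @[n --> \oo] --> qpoch_inf a p * qpoch_inf (- a) p.
  by apply: cvgM; exact: qpoch_cvg.
have h2 : qpoch a p n * qpoch (- a) p n @[n --> \oo] --> qpoch_inf (a ^+ 2) (p ^+ 2).
  have -> : (fun n => qpoch a p n * qpoch (- a) p n) = qpoch (a ^+ 2) (p ^+ 2).
    apply/funext => n; rewrite /qpoch -big_split; apply: eq_bigr => k _ /=.
    by rewrite -exprM mulnC exprM -exprMn; ring.
  exact: qpoch_cvg.
by apply: cvg_unique h1 h2; exact: norm_hausdorff.
Qed.

Lemma qpoch_mod (a : C) (m n : nat) :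
  qpoch a p (m * n) = \prod_(i < m) qpoch (a * p ^+ i) (p ^+ m) n.
Proof.
elim: n => [|n IH].
  by rewrite muln0 qpoch0 big1 // => i _; rewrite qpoch0.
rewrite mulnS addnC qpochD IH [X in _ * X]/qpoch -big_split; apply: eq_bigr => i _ /=.
by rewrite qpochS -exprM; congr (_ * (1 - _)); ring.
Qed.

Lemma qpoch_inf_mod (a : C) (m : nat) : (0 < m)%N ->
  qpoch_inf a p = \prod_(i < m) qpoch_inf (a * p ^+ i) (p ^+ m).
Proof.
move=> m0.
have p20 : p ^+ m != 0 by rewrite expf_neq0.
have p21 : `|p ^+ m| < 1 by rewrite normrX exprn_ilt1 // -lt0n.
have h1 : qpoch a p (m * n) @[n --> \oo] --> qpoch_inf a p.
  have h := cvg_comp (muln m) (qpoch a p) (cvg_mulnl m m0) (qpoch_cvg p0 p1 (a := a)).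
  exact: h.
have h2 k : \prod_(i < k) qpoch (a * p ^+ i) (p ^+ m) n @[n --> \oo] -->
    \prod_(i < k) qpoch_inf (a * p ^+ i) (p ^+ m).
  elim: k => [|k IH].
    rewrite big_ord0 (_ : (fun n => _) = (fun=> 1)); first exact: cvg_cst.
    by apply/funext => n; rewrite big_ord0.
  rewrite big_ord_recr (_ : (fun n => _) = (fun n => (\prod_(i < k) qpoch (a * p ^+ i) (p ^+ m) n)
    * qpoch (a * p ^+ k) (p ^+ m) n)); last by apply/funext => n; rewrite big_ord_recr.
  by apply: cvgM; [exact: IH | exact: (qpoch_cvg p20 p21)].
have h3 : (fun n => qpoch a p (m * n)) = (fun n => \prod_(i < m) qpoch (a * p ^+ i) (p ^+ m) n).
  by apply/funext => n; exact: qpoch_mod.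
rewrite h3 in h1; by apply: cvg_unique h1 (h2 m); exact: norm_hausdorff.
Qed.
End ProductIdentities.

Section Parity.
Variable C : numFieldType.

Lemma has_sum_parity (f : int -> C) (a b : C) :
  has_sum (fun m : int => f (2 * m)) a -> has_sum (fun m : int => f (2 * m + 1)) b ->
  has_sum f (a + b).
Proof.
move=> ha hb; pose e (d : int) := ~~ odd (absz d).
have h1 : has_sum (fun d => if e d then f d else 0) a.
  apply/(has_sum_reindex (h := fun m : int => 2 * m)) => [m n|d h|]; first by lia.
    case: ifP => // ed; case: (h (if 0 <= d then Posz (absz d)./2 else - Posz (absz d)./2)).
    by move: ed; rewrite /e; case: ifP; lia.
  by apply: eq_has_sum ha => m /=; rewrite ifT // /e; lia.
have h2 : has_sum (fun d => if e d then 0 else f d) b.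
  apply/(has_sum_reindex (h := fun m : int => 2 * m + 1)) => [m n|d h|]; first by lia.
    case: ifP => // ed; case: (h (if 0 <= d then Posz (absz d)./2 else - Posz (absz d)./2 - 1)).
    by move: ed; rewrite /e; case: ifP; lia.
  by apply: eq_has_sum hb => m /=; rewrite ifF // /e; lia.
by apply: eq_has_sum (has_sumD h1 h2) => d; case: ifP => _; rewrite ?addr0 ?add0r.
Qed.

End Parity.

Section Theta.
Variable R : realType.
Local Notation C := (R[i] : numFieldType).
Local Notation P := (@qpoch_inf C).
Implicit Type z : C.

Lemma expr_punctured_disc z n : (0 < n)%N -> z != 0 -> `|z| < 1 -> z ^+ n != 0 /\ `|z ^+ n| < 1.
Proof. by move=> n0 z0 z1; rewrite expf_neq0 // normrX exprn_ilt1 // -lt0n. Qed.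

Lemma oppr_punctured_disc z : z != 0 -> `|z| < 1 -> - z != 0 /\ `|- z| < 1.
Proof. by rewrite oppr_eq0 normrN. Qed.

Lemma qpoch_inf_mod2 z a : z != 0 -> `|z| < 1 -> P a z = P a (z ^+ 2) * P (a * z) (z ^+ 2).
Proof.
move=> z0 z1; rewrite (qpoch_inf_mod z0 z1 a (ltn0Sn 1)).
by rewrite !big_ord_recl big_ord0 /= expr0 expr1 !mulr1.
Qed.

Lemma qpoch_inf_mod3 z a : z != 0 -> `|z| < 1 ->
  P a z = P a (z ^+ 3) * P (a * z) (z ^+ 3) * P (a * z ^+ 2) (z ^+ 3).
Proof.
move=> z0 z1; rewrite (qpoch_inf_mod z0 z1 a (ltn0Sn 2)).
by rewrite !big_ord_recl big_ord0 /= expr0 expr1 !mulr1 mulrA.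
Qed.

Lemma qpoch_inf_self_neq0 z : z != 0 -> `|z| < 1 -> P z z != 0.
Proof. by move=> z0 z1; exact: qpoch_inf_neq0. Qed.

Lemma qpoch_inf_odd z : z != 0 -> `|z| < 1 -> P z (z ^+ 2) = P z z / P (z ^+ 2) (z ^+ 2).
Proof.
move=> z0 z1; have [h0 h1] := @expr_punctured_disc z 2 isT z0 z1.
by rewrite (qpoch_inf_mod2 z z0 z1) -expr2 mulfK // qpoch_inf_self_neq0.
Qed.

Lemma qpoch_inf_opp z : z != 0 -> `|z| < 1 -> P (- z) z = P (z ^+ 2) (z ^+ 2) / P z z.
Proof.
move=> z0 z1; have := qpoch_inf_sqr z0 z1 z => <-.
by rewrite [RHS]mulrC mulKf // qpoch_inf_self_neq0.
Qed.

Lemma qpoch_inf_opp_odd z : z != 0 -> `|z| < 1 ->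
  P (- z) (z ^+ 2) = P (z ^+ 2) (z ^+ 2) ^+ 2 / (P z z * P (z ^+ 4) (z ^+ 4)).
Proof.
move=> z0 z1; have [h0 h1] := @expr_punctured_disc z 2 isT z0 z1.
have [k0 k1] := @expr_punctured_disc z 4 isT z0 z1.
have := qpoch_inf_sqr h0 h1 z; rewrite (qpoch_inf_odd z0 z1) (qpoch_inf_odd h0 h1).
rewrite -exprM -[(2 * 2)%N]/4%N.
move: (qpoch_inf_self_neq0 z0 z1) (qpoch_inf_self_neq0 h0 h1) (qpoch_inf_self_neq0 k0 k1).
move: (P z z) (P (z ^+ 2) (z ^+ 2)) (P (z ^+ 4) (z ^+ 4)) (P (- z) _) => J1 J2 J4 X a1 a2 a4.
move=> /(canRL (mulKf (_ : J1 / J2 != 0))) -> //; last by rewrite mulf_neq0 ?invr_neq0.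
by field; rewrite a1 a2 a4.
Qed.

Lemma qpoch_inf_opp1 z : z != 0 -> `|z| < 1 -> P (-1) z = 2 * P (- z) z.
Proof.
move=> z0 z1.
by rewrite (qpoch_inf_split z0 z1 (-1) 1) expr1 mulN1r /qpoch big_ord_recl big_ord0 expr0 !mulr1 opprK.
Qed.

Lemma phi_sum z : z != 0 -> `|z| < 1 -> has_sum (fun d : int => z ^ (d * d))
  (P (- z) (z ^+ 2) ^+ 2 * P (z ^+ 2) (z ^+ 2)).
Proof.
move=> z0 z1; have := jacobi_triple_sq z0 z1 (oner_neq0 _); rewrite mulr1 divr1 -expr2.
by apply: eq_has_sum => d; rewrite exp1rz mulr1.
Qed.

(** Compared with (- z; z^2)_inf, one factor of the triple product gains 1 + 1 / z and the other
    loses 1 + z; their quotient is the prefactor 1 / z. *)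
Lemma shifted_phi_sum z : z != 0 -> `|z| < 1 ->
  has_sum (fun d : int => z ^ (- 2 * d) * z ^ (d * d))
    (z^-1 * (P (- z) (z ^+ 2) ^+ 2 * P (z ^+ 2) (z ^+ 2))).
Proof.
move=> z0 z1; have w0 : z ^- 2 != 0 by rewrite invr_neq0 // expf_neq0.
have := jacobi_triple_sq z0 z1 w0.
rewrite (_ : - (z * z ^- 2) = - z^-1); last by field.
rewrite (_ : - (z / z ^- 2) = - z * z ^+ 2); last by field.
have [h0 h1] := @expr_punctured_disc z 2 isT z0 z1.
have -> : P (- z^-1) (z ^+ 2) = (1 + z^-1) * P (- z) (z ^+ 2).
  rewrite (qpoch_inf_split h0 h1 (- z^-1) 1) expr1 (_ : - z^-1 * z ^+ 2 = - z); last by field.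
  by rewrite /qpoch big_ord_recl big_ord0 expr0 !mulr1 opprK.
have e : P (- z) (z ^+ 2) = (1 + z) * P (- z * z ^+ 2) (z ^+ 2).
  by rewrite {1}(qpoch_inf_split h0 h1 (- z) 1) expr1 /qpoch big_ord_recl big_ord0 expr0 !mulr1 opprK.
rewrite [X in has_sum _ X -> _](_ : _ = z^-1 * (P (- z) (z ^+ 2) ^+ 2 * P (z ^+ 2) (z ^+ 2))).
  apply: eq_has_sum => d; rewrite mulrC; congr (_ * _).
  by rewrite -[z ^- 2]/(z ^ (- 2)) exprz_exp.
rewrite e; move: (P _ _) (P _ _) => X Y.
by field.
Qed.

Lemma psi_sum z : z != 0 -> `|z| < 1 -> has_sum (fun d : int => z ^ (- d) * z ^ (d * d))
  (2 * P (z ^+ 4) (z ^+ 4) ^+ 2 / P (z ^+ 2) (z ^+ 2)).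
Proof.
move=> z0 z1; have w0 : z^-1 != 0 by rewrite invr_neq0.
have [h0 h1] := @expr_punctured_disc z 2 isT z0 z1.
have := jacobi_triple_sq z0 z1 w0; rewrite divff // invrK -expr2.
rewrite (qpoch_inf_opp1 h0 h1) (qpoch_inf_opp h0 h1) -exprM -[(2 * 2)%N]/4%N.
rewrite [X in has_sum _ X -> _](_ : _ = 2 * P (z ^+ 4) (z ^+ 4) ^+ 2 / P (z ^+ 2) (z ^+ 2)).
  by apply: eq_has_sum => d; rewrite mulrC exprz_inv.
move: (P (z ^+ 4) _) (P (z ^+ 2) _) (qpoch_inf_self_neq0 h0 h1) => X Y Y0.
by field.
Qed.

(** The triple product is (- z, - z^5, z^6; z^6)_inf. Trisecting (- z; z^2)_inf gives its first two
    factors times (- z^3; z^6)_inf, and [qpoch_inf_opp_odd] evaluates both odd products. *)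
Lemma theta13_sum z : z != 0 -> `|z| < 1 ->
  has_sum (fun d : int => z ^ (2 * (d * d) - 2 * d) * z ^ (d * d))
  (P (z ^+ 2) (z ^+ 2) ^+ 2 * P (z ^+ 3) (z ^+ 3) * P (z ^+ 12) (z ^+ 12) /
   (P z z * P (z ^+ 4) (z ^+ 4) * P (z ^+ 6) (z ^+ 6))).
Proof.
move=> z0 z1; have [h0 h1] := @expr_punctured_disc z 2 isT z0 z1.
have [t0 t1] := @expr_punctured_disc z 3 isT z0 z1.
have w0 : z ^- 2 != 0 by rewrite invr_neq0 // expf_neq0.
have := jacobi_triple_sq t0 t1 w0.
rewrite (_ : - (z ^+ 3 * z ^- 2) = - z); last by field.
rewrite (_ : - (z ^+ 3 / z ^- 2) = - z * (z ^+ 2) ^+ 2); last by field.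
have e3 := qpoch_inf_opp_odd z0 z1; have e2 := qpoch_inf_opp_odd t0 t1.
have e1 := qpoch_inf_mod3 (- z) h0 h1; rewrite e3 in e1.
rewrite (_ : - z * z ^+ 2 = - z ^+ 3) in e1; last by ring.
rewrite (_ : (z ^+ 2) ^+ 3 = (z ^+ 3) ^+ 2) in e1; last by ring.
rewrite e2 in e1.
have [a1 a2] := (qpoch_inf_self_neq0 z0 z1, qpoch_inf_self_neq0 h0 h1).
have a3 := qpoch_inf_self_neq0 t0 t1.
have [k0 k1] := @expr_punctured_disc z 4 isT z0 z1; have a4 := qpoch_inf_self_neq0 k0 k1.
have [k60 k61] := @expr_punctured_disc z 6 isT z0 z1; have a6 := qpoch_inf_self_neq0 k60 k61.
have [k120 k121] := @expr_punctured_disc z 12 isT z0 z1; have a12 := qpoch_inf_self_neq0 k120 k121.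
rewrite -[z ^+ 6]/(z ^+ (3 * 2)) -[z ^+ 12]/(z ^+ (3 * 4)) !exprM in a6 a12 *.
rewrite [X in has_sum _ X -> _](_ : _ = P (z ^+ 2) (z ^+ 2) ^+ 2 * P (z ^+ 3) (z ^+ 3) *
   P ((z ^+ 3) ^+ 4) ((z ^+ 3) ^+ 4) /
   (P z z * P (z ^+ 4) (z ^+ 4) * P ((z ^+ 3) ^+ 2) ((z ^+ 3) ^+ 2))).
  apply: eq_has_sum => d; rewrite -[z ^- 2]/(z ^ (- 2)) -[z ^+ 3]/(z ^ 3) !exprz_exp -!expfzDr //.
  by congr (z ^ _); ring.
move: e1 a1 a2 a3 a4 a6 a12; clear.
move: (P z z) (P (z ^+ 2) (z ^+ 2)) (P (z ^+ 3) (z ^+ 3)) (P (z ^+ 4) (z ^+ 4)).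
move: (P ((z ^+ 3) ^+ 2) ((z ^+ 3) ^+ 2)) (P ((z ^+ 3) ^+ 4) ((z ^+ 3) ^+ 4)).
move: (P (- z) _) (P (- z * _) _) => A B J6 J12 J1 J2 J3 J4 e1 a1 a2 a3 a4 a6 a12.
transitivity (A * (J6 ^+ 2 / (J3 * J12)) * B * (J3 * J12 / J6)); first by field; rewrite ?a3 ?a6 ?a12.
by rewrite -e1; field; rewrite ?a1 ?a4 ?a6.
Qed.

End Theta.

(** * Theta products of modulus 12 *)

Section Theta12.
Variable R : realType.
Local Notation C := (R[i] : numFieldType).
Local Notation P := (@qpoch_inf C).
Implicit Type z : C.

(** J_(a,12) with [z] in the role of q. *)
Definition theta12 z (a : nat) : C :=
  P (z ^+ a) (z ^+ 12) * P (z ^+ (12 - a)) (z ^+ 12) * P (z ^+ 12) (z ^+ 12).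

Lemma theta12_5 z : z != 0 -> `|z| < 1 ->
  has_sum (fun m : int => (-1) ^ m * z ^ (6 * (m * m) - m)) (theta12 z 5).
Proof.
move=> z0 z1; have [h0 h1] := @expr_punctured_disc _ z 6 isT z0 z1.
have w0 : - z^-1 != 0 by rewrite oppr_eq0 invr_neq0.
have := jacobi_triple_sq h0 h1 w0.
rewrite (_ : - (z ^+ 6 * - z^-1) = z ^+ 5); last by field.
rewrite (_ : - (z ^+ 6 / - z^-1) = z ^+ 7); last by field; rewrite ?oppr_eq0 ?oner_neq0 ?z0.
rewrite -exprM -[(6 * 2)%N]/12%N; apply: eq_has_sum => m.
rewrite -[- z^-1]mulN1r [(-1 * _) ^ m]exprzMl ?unitrN1 ?unitfE ?invr_neq0 // exprz_inv -[z ^+ 6]/(z ^ 6) exprz_exp.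
by rewrite mulrCA -expfzDr.
Qed.

Lemma theta12_1 z : z != 0 -> `|z| < 1 ->
  has_sum (fun m : int => (-1) ^ m * z ^ (6 * (m * m) + 5 * m)) (theta12 z 1).
Proof.
move=> z0 z1; have [h0 h1] := @expr_punctured_disc _ z 6 isT z0 z1.
have [k0 k1] := @expr_punctured_disc _ z 5 isT z0 z1.
have w0 : - z ^+ 5 != 0 by rewrite oppr_eq0.
have := jacobi_triple_sq h0 h1 w0.
rewrite (_ : - (z ^+ 6 * - z ^+ 5) = z ^+ 11); last by ring.
rewrite (_ : - (z ^+ 6 / - z ^+ 5) = z ^+ 1); last by field; rewrite ?oppr_eq0.
rewrite -exprM -[(6 * 2)%N]/12%N [X in X * _]mulrC; apply: eq_has_sum => m.
rewrite -[- z ^+ 5]mulN1r [(-1 * _) ^ m]exprzMl ?unitrN1 ?unitfE // -[z ^+ 6]/(z ^ 6) -[z ^+ 5]/(z ^ 5) !exprz_exp.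
by rewrite mulrCA -expfzDr.
Qed.

Lemma triangle_even m : (triangle (2 * m))%:Z = 2 * (m * m) - m.
Proof. by have := triangle_double (2 * m); nia. Qed.

Lemma triangle_odd m : (triangle (2 * m + 1))%:Z = 2 * (m * m) + m.
Proof. by have := triangle_double (2 * m + 1); nia. Qed.

Lemma exprN1_double (m k : int) : (-1 : C) ^ (2 * m + k) = (-1) ^ k.
Proof. by rewrite exprzDr ?unitrN1 // -exprz_exp -[(-1) ^ 2]/((-1) ^+ 2) sqrrN expr1n exp1rz mul1r. Qed.

Lemma exprN1_opp (m : int) : (-1 : C) ^ (- m) = (-1) ^ m.
Proof. by rewrite -exprz_inv invrN invr1. Qed.

Lemma expfz_mulACA (x y : C) (k l m n : int) : x != 0 -> y != 0 ->
  x ^ k * y ^ l * (x ^ m * y ^ n) = x ^ (k + m) * y ^ (l + n).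
Proof. by move=> x0 y0; rewrite mulrACA (expfzDr k m x0) (expfzDr l n y0). Qed.

(* [f(z, -z^2)] and [f(-z, z^2)] of Ramanujan's general theta function,
   each split into its even and odd terms. *)
Lemma theta3_split z (e : bool) : z != 0 -> `|z| < 1 ->
  theta12 z 5 + (-1) ^+ e * z * theta12 z 1 =
  P (- ((-1) ^+ e * z)) (- z ^+ 3) * P ((-1) ^+ e * z ^+ 2) (- z ^+ 3) * P (- z ^+ 3) (- z ^+ 3).
Proof.
move=> z0 z1; have [t0 t1] := @expr_punctured_disc _ z 3 isT z0 z1.
have [n0 n1] := oppr_punctured_disc t0 t1.
have w0 : (-1) ^+ e * z != 0 by rewrite mulf_neq0 ?signr_eq0.
have := jacobi_triple n0 n1 w0.
rewrite (_ : - (- z ^+ 3 / ((-1) ^+ e * z)) = (-1) ^+ e * z ^+ 2); last first.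
  by case: e {w0}; rewrite ?expr1 ?expr0; field; rewrite ?oppr_eq0 ?oner_neq0.
apply: has_sum_unique.
have cE k : (- z ^+ 3) ^+ triangle k = (-1) ^ (triangle k)%:Z * z ^ (3 * (triangle k)%:Z).
  by rewrite exprNn -exprM.
have dE k : ((-1) ^+ e * z) ^ k = (-1) ^ (e%:Z * k) * z ^ k.
  by rewrite exprzMl ?unitfE ?signr_eq0 // -exprz_exp.
have N1 : (-1 : C) != 0 by rewrite oppr_eq0 oner_neq0.
apply: has_sum_parity.
  apply: eq_has_sum (theta12_5 z0 z1) => m.
  rewrite cE dE triangle_even [RHS](expfz_mulACA _ _ _ _ N1 z0).
  congr (_ * z ^ _); last by ring.
  by rewrite -exprN1_opp -(exprN1_double (m * m + e%:Z * m)); congr (_ ^ _); ring.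
apply: eq_has_sum (has_sumZ ((-1) ^+ e * z) (theta12_1 z0 z1)) => m.
rewrite cE dE triangle_odd [RHS](expfz_mulACA _ _ _ _ N1 z0).
rewrite [X in X * _ = _](_ : _ = (-1) ^ e%:Z * z ^ 1) // [LHS](expfz_mulACA _ _ _ _ N1 z0).
congr (_ * z ^ _); last by ring.
by rewrite -(exprN1_double (m * m + e%:Z * m)); congr (_ ^ _); ring.
Qed.

(** With [e] false the three products to the base - z^3 recombine into (- z; - z)_inf = (- z;
    z^2)_inf (z^2; z^2)_inf. *)
Lemma phi_theta12 z : z != 0 -> `|z| < 1 ->
  P (- z) (z ^+ 2) ^+ 2 * P (z ^+ 2) (z ^+ 2) =
  P (- z) (z ^+ 2) * (theta12 z 5 + z * theta12 z 1).
Proof.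
move=> z0 z1; have [n0 n1] := oppr_punctured_disc z0 z1.
have := theta3_split false z0 z1; rewrite expr0 !mul1r => ->.
have := qpoch_inf_mod3 (- z) n0 n1.
rewrite (_ : - z * - z = z ^+ 2); last by ring.
rewrite (_ : - z * (- z) ^+ 2 = - z ^+ 3); last by ring.
rewrite (_ : (- z) ^+ 3 = - z ^+ 3); last by ring.
move=> e1; have e2 := qpoch_inf_mod2 (- z) n0 n1.
rewrite sqrrN (_ : - z * - z = z ^+ 2) in e2; last by ring.
transitivity (P (- z) (z ^+ 2) * P (- z) (- z)); last by congr (_ * _).
by rewrite e2 expr2 mulrA.
Qed.

(** With [e] true the first two products to the base - z^3 form (z; - z)_inf up to the missing third
    (z^3; - z^3)_inf, called [D] below; both of these are quotients by [qpoch_inf_opp]. *)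
Lemma phi3_theta12 z : z != 0 -> `|z| < 1 ->
  P (- z ^+ 3) (z ^+ 6) ^+ 2 * P (z ^+ 6) (z ^+ 6) =
  P (- z) (z ^+ 2) * (theta12 z 5 - z * theta12 z 1).
Proof.
move=> z0 z1; have [n0 n1] := oppr_punctured_disc z0 z1.
have [t0 t1] := @expr_punctured_disc _ z 3 isT z0 z1; have [nt0 nt1] := oppr_punctured_disc t0 t1.
have := theta3_split true z0 z1; rewrite expr1 !mulN1r opprK mulNr => ->.
have e1 := qpoch_inf_mod3 z n0 n1.
rewrite (_ : z * - z = - z ^+ 2) in e1; last by ring.
rewrite (_ : z * (- z) ^+ 2 = z ^+ 3) in e1; last by ring.
rewrite (_ : (- z) ^+ 3 = - z ^+ 3) in e1; last by ring.
have e2 := qpoch_inf_opp n0 n1; rewrite opprK sqrrN e1 in e2.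
have e3 := qpoch_inf_opp nt0 nt1; rewrite opprK sqrrN -exprM -[(3 * 2)%N]/6%N in e3.
have e4 := qpoch_inf_mod2 (- z) n0 n1; rewrite sqrrN (_ : - z * - z = z ^+ 2) in e4; last by ring.
have e5 := qpoch_inf_mod2 (- z ^+ 3) nt0 nt1.
rewrite sqrrN -exprM -[(3 * 2)%N]/6%N (_ : - z ^+ 3 * - z ^+ 3 = z ^+ 6) in e5; last by ring.
have [h0 h1] := @expr_punctured_disc _ z 2 isT z0 z1; have [k0 k1] := @expr_punctured_disc _ z 6 isT z0 z1.
have a1 := qpoch_inf_self_neq0 n0 n1; have a2 := qpoch_inf_self_neq0 h0 h1.
have a3 := qpoch_inf_self_neq0 nt0 nt1; have a6 := qpoch_inf_self_neq0 k0 k1.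
move: e2 e3 e4 e5 a1 a2 a3 a6; clear.
move: (P (- z) (- z)) (P (z ^+ 2) (z ^+ 2)) (P (- z ^+ 3) (- z ^+ 3)) (P (z ^+ 6) (z ^+ 6)).
move: (P (- z) (z ^+ 2)) (P (- z ^+ 3) (z ^+ 6)) (P z (- z ^+ 3)) (P (- z ^+ 2) _) (P (z ^+ 3) _).
move=> X Y A B D J1 J2 J3 J6 e2 e3 e4 e5 a1 a2 a3 a6.
have Y0 : Y != 0 by apply: contraNneq a3 => Y0; rewrite e5 Y0 mul0r.
have X0 : X != 0 by apply: contraNneq a1 => X0; rewrite e4 X0 mul0r.
have D0 : D != 0 by rewrite e3 mulf_neq0 ?invr_neq0.
have -> : A * B = J2 / J1 / D by rewrite -e2 mulfK.
by rewrite e3 e4 e5; field; rewrite Y0 X0 a2 a6.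
Qed.

End Theta12.

(** * The seven Nahm sums *)

Section NahmSums.
Variable R : realType.
Local Notation C := (R[i] : numFieldType).
Variable q : C.
Hypotheses (q0 : q != 0) (q1 : `|q| < 1).
Local Notation p := (q ^+ 4).
Local Notation P := (@qpoch_inf C).
Let p0 := expf4_neq0 q0.
Let p1 := normrX4_lt1 q1.

Lemma norm_expz_le1 (e : int) : 0 <= e -> `|q ^ e| <= 1.
Proof.
move=> e0; have := @norm_expz_le _ q q0 q1 e 0 0.
by rewrite !expr0 invr1 mulr1; apply; rewrite addr0.
Qed.

(** b3 = 2 - b1 makes the parameter of the symbol in [nahm_right] equal to - p, as [right_seq]
    requires; five of the seven cases are of this kind. *)
Lemma nahm_sum_pair (b1 b2 b3 : int) (c : int -> C) (theta K : C) :
  b3 = 2 - b1 -> -2 <= b1 -> -2 <= b2 -> 0 <= b3 ->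
  (forall n, conv (left_seq p (q ^ (b1 + b2)) (q ^ b3))
    (upsample (right_seq p (q ^ b3))) n = pair_sum p c n) ->
  (forall d, `|c d * q ^+ (2 * absz d)| <= K) ->
  has_sum (fun d => c d * q ^ (d * d)) theta ->
  nahm_sum_is q b1 b2 b3 (P (- q ^ (2 + b1)) p * P (- p) p * (theta / P p p)).
Proof.
move=> hb hb1 hb2 hb3 hc hK htheta.
have e4 : 2 + b1 + b3 = 4 by lia.
have -> : P (- p) p = P (- q ^ (2 + b1 + b3)) p by rewrite e4.
apply: nahm_reduction => //; first by rewrite e4.
apply: eq_has_sum (has_sum_pair_sum q0 q1 hK htheta) => n.
rewrite -hc -conv_upsample; congr (_ * _); apply: eq_bigr => k _.
rewrite /nahm_left /nahm_right /left_seq /right_seq e4 -hb.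
by rewrite [in LHS]exprnP [in X in _ * X]exprnP !exprz_exp.
Qed.

Lemma pair_sum2E (c : int -> C) n :
  pair_sum2 p (fun a b => c (a%:Z - b%:Z)) n = pair_sum p c n.
Proof. by []. Qed.

(* The suffixes spell out [(b1, b2, b3)], with [m] for a minus sign. *)
Lemma nahm_sum_m204 (theta : C) :
  has_sum (fun d : int => q ^ (- 2 * d) * q ^ (d * d)) theta ->
  nahm_sum_is q (-2) 0 4 (P (-1) p * P (- p) p * (theta / P p p)).
Proof.
apply: (@nahm_sum_pair (-2) 0 4 _ _ 1) => // [n|d].
  rewrite -pair_sum2E [q ^ 4](_ : _ = (q ^ 2) ^+ 2); last by rewrite -[q ^ 2]/(q ^+ 2) -exprM.
  rewrite (@conv_geom_pair_sum _ _ p1) => [|]; last by rewrite -[q ^ 2]/(q ^+ 2) -exprM -[q ^ _]/(q ^- 2); field.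
  apply: eq_pair_sum2 => a b.
  rewrite !exprnP !exprz_exp -expfzDr //; congr (q ^ _); ring.
by rewrite exprnP -expfzDr // norm_expz_le1 //; lia.
Qed.

Lemma nahm_sum_0m12 (theta : C) :
  has_sum (fun d : int => q ^ (- d) * q ^ (d * d)) theta ->
  nahm_sum_is q 0 (-1) 2 (P (- q ^+ 2) p * P (- p) p * (theta / P p p)).
Proof.
apply: (@nahm_sum_pair 0 (-1) 2 _ _ 1) => // [n|d].
  rewrite -pair_sum2E -[q ^ 2]/(q ^+ 2).
  rewrite (@conv_geom_pair_sum _ _ p1) => [|]; last by rewrite -[q ^ _]/(q ^-1); field.
  apply: eq_pair_sum2 => a b.
  rewrite !exprnP !exprz_exp -expfzDr //; congr (q ^ _); ring.
by rewrite exprnP -expfzDr // norm_expz_le1 //; lia.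
Qed.

Lemma nahm_sum_2m20 (theta : C) :
  has_sum (fun d : int => q ^ (d * d)) theta ->
  nahm_sum_is q 2 (-2) 0 (P (- p) p * P (- p) p * (theta / P p p)).
Proof.
move=> h; apply: (@nahm_sum_pair 2 (-2) 0 (fun=> 1) _ 1) => // [n|d|].
- rewrite -pair_sum2E (_ : q ^ 0 = 1 ^+ 2); last by rewrite expr1n.
  rewrite (@conv_geom_pair_sum _ _ p1) ?expr1n ?mulr1 //.
  by apply: eq_pair_sum2 => a b; rewrite !expr1n mulr1.
- by rewrite mul1r exprnP norm_expz_le1.
by apply: eq_has_sum h => d; rewrite mul1r.
Qed.

Lemma nahm_sum_200 (theta : C) :
  has_sum (fun d : int => q ^ (2 * (d * d)) * q ^ (d * d)) theta ->
  nahm_sum_is q 2 0 0 (P (- p) p * P (- p) p * (theta / P p p)).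
Proof.
apply: (@nahm_sum_pair 2 0 0 _ _ 1) => // [n|d].
  rewrite -pair_sum2E (_ : q ^ 0 = 1) // (_ : q ^ (2 + 0) = q ^+ 2) //.
  rewrite (@conv_square_pair_sum _ _ p1) ?expf_neq0 -?exprM //.
  by apply: eq_pair_sum2 => a b; rewrite -[q ^+ 2]/(q ^ 2) exprz_exp.
by rewrite exprnP -expfzDr // norm_expz_le1 //; nia.
Qed.

Lemma nahm_sum_m224 (theta : C) :
  has_sum (fun d : int => q ^ (2 * (d * d) - 2 * d) * q ^ (d * d)) theta ->
  nahm_sum_is q (-2) 2 4 (P (-1) p * P (- p) p * (theta / P p p)).
Proof.
apply: (@nahm_sum_pair (-2) 2 4 _ _ 1) => // [n|d].
  rewrite -pair_sum2E (_ : q ^ (-2 + 2) = 1) // -[q ^ 4]/(q ^+ 4).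
  rewrite (@conv_pronic_pair_sum _ _ p1 (q ^+ 2)) ?expf_neq0 -?exprM //.
  by apply: eq_pair_sum2 => a b; rewrite -[q ^+ 2]/(q ^ 2) exprz_exp mulrBr.
by rewrite exprnP -expfzDr // norm_expz_le1 //; nia.
Qed.

Section Half.
Let t := - q ^+ 2.
Let t0 : t != 0. Proof. by rewrite oppr_eq0 expf_neq0. Qed.
Let tp : t ^+ 2 = p. Proof. by rewrite sqrrN -exprM. Qed.

Lemma half_bound (e : C) (d : int) : `|e| <= 1 ->
  `|(1 + e * q ^ (2 * (d * d))) / 2 * q ^+ (2 * absz d)| <= 1.
Proof.
move=> e1; rewrite normrM; apply: mulr_ile1 => //; last by rewrite exprnP norm_expz_le1.
rewrite normrM normfV (ger0_norm (ler0n _ 2)) // ler_pdivrMr // mul1r.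
apply: le_trans (ler_normD _ _) _; rewrite normr1 -[leRHS]/(1 + 1) lerD2l normrM.
by apply: mulr_ile1 => //; apply: norm_expz_le1; nia.
Qed.

Lemma square_pair_sumE n : square_pair_sum p (- t) n = pair_sum p (fun d => q ^ (2 * (d * d))) n.
Proof.
by rewrite -pair_sum2E; apply: eq_pair_sum2 => a b; rewrite opprK -[q ^+ 2]/(q ^ 2) exprz_exp.
Qed.

Lemma half_pair (e : C) n :
  (pair_sum2 p (fun _ _ => 1) n + e * square_pair_sum p (- t) n) / 2 =
  pair_sum p (fun d => (1 + e * q ^ (2 * (d * d))) / 2) n.
Proof.
rewrite square_pair_sumE /pair_sum2 /pair_sum mulr_sumr -big_split mulr_suml.
apply: eq_bigr => k _ /=.
by rewrite mulrA -mulrDl mulrAC.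
Qed.

Lemma nahm_sum_000 (theta : C) :
  has_sum (fun d : int => (1 + 1 * q ^ (2 * (d * d))) / 2 * q ^ (d * d)) theta ->
  nahm_sum_is q 0 0 0 (P (- q ^+ 2) p * P (- q ^+ 2) p * (theta / P p p)).
Proof.
move=> h; apply: (@nahm_reduction _ _ q0 q1 0 0 0) => //.
have hK d := @half_bound 1 d (_ : `|1| <= 1).
have {}hK d : `|(1 + 1 * q ^ (2 * (d * d))) / 2 * q ^+ (2 * absz d)| <= 1.
  by apply: hK; rewrite normr1.
apply: eq_has_sum (has_sum_pair_sum q0 q1 hK h) => n.
rewrite -half_pair mul1r -(conv_half_even p1 t0 tp) -conv_upsample.
congr (_ * _); apply: eq_bigr => k _.
rewrite /nahm_left /nahm_right /left_seq !mul0r expr0z mul1r.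
rewrite opprK expr1n mul1r.
have -> : - q ^ (2 - 0) = t by [].
by rewrite div1r.
Qed.

Lemma nahm_sum_024 (theta : C) :
  has_sum (fun d : int => (1 + -1 * q ^ (2 * (d * d))) / 2 * q ^ (d * d)) theta ->
  nahm_sum_is q 0 2 4 (q^-1 * (P (- q ^+ 2) p * P (- q ^+ 2) p * (theta / P p p))).
Proof.
move=> h.
have hK d : `|(1 + -1 * q ^ (2 * (d * d))) / 2 * q ^+ (2 * absz d)| <= 1.
  by apply: half_bound; rewrite normrN normr1.
(* The reduction produces (- q^6; p)_inf. The factor 1 + q^2 relating it to (- q^2; p)_inf is the
   first factor of (t; p)_(k + 1), and 1 / q will come from the shift of n. *)
have e2 : P (- q ^+ 2) p = (1 + q ^+ 2) * P (- q ^+ 6) p.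
  rewrite (qpoch_inf_split p0 p1 (- q ^+ 2) 1) expr1 mulNr -exprD.
  by rewrite /qpoch big_ord_recl big_ord0 expr0 !mulr1 opprK.
rewrite [X in nahm_sum_is _ _ _ _ X](_ : _ = P (- q ^ (2 + 0)) p * P (- q ^ (2 + 0 + 4)) p *
   (q^-1 * (1 + q ^+ 2) * (theta / P p p))); last first.
  rewrite -[q ^ (2 + 0)]/(q ^+ 2) -[q ^ (2 + 0 + 4)]/(q ^+ 6) {2}e2.
  by move: (P _ _) (P _ _) (theta / _) => x y z; ring.
apply: (@nahm_reduction _ _ q0 q1 0 2 4) => //.
have hs := has_sum_pair_sum q0 q1 hK h.
have e0 n : q ^+ (n * n) * pair_sum p (fun d => (1 + -1 * q ^ (2 * (d * d))) / 2) n =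
   q ^+ (n * n) * ((pair_sum2 p (fun _ _ => 1) n - square_pair_sum p (- t) n) / 2).
  by rewrite -half_pair mulN1r.
(* Both pair sums are 1 at n = 0, so their difference vanishes there and the series may start at n =
   1. *)
have f0 : q ^+ (0 * 0) * pair_sum p (fun d => (1 + -1 * q ^ (2 * (d * d))) / 2) 0 = 0.
  by rewrite e0 /square_pair_sum !pair_sum2_0 // subrr mul0r mulr0.
have /(has_sumZ (q^-1 * (1 + q ^+ 2))) := (has_sum_succ _ f0).1 hs.
apply: eq_has_sum => n; rewrite e0 -(conv_half_odd p1 t0 tp) -conv_upsample.
rewrite !mulr_sumr; apply: eq_bigr => k _.
have kn : (k.*2 <= n)%N by have := ltn_ord k; lia.
rewrite /nahm_left /nahm_right /left_seq qpochSl opprK expr1n mul1r.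
have -> : t * p = - q ^ (2 + 0 + 4) by rewrite /t mulNr -exprD.
rewrite add0r subr0 -[q ^ 2]/(q ^+ 2) opprK.
have -> : q ^ (2 * (n - k.*2)%N%:Z) = q ^+ (2 * (n - k.*2)) by [].
have -> : q ^ (4 * k%:Z) = q ^+ (4 * k) by [].
(* With n = j + 2 k, (n + 1)^2 = n^2 + 2 j + 4 k + 1: the shift absorbs the linear weights b2 = 2
   and b3 = 4. *)
have -> : q ^+ (n.+1 * n.+1) = q * (q ^+ (n * n) * (q ^+ (2 * (n - k.*2)) * q ^+ (4 * k))).
  by rewrite -!exprD -exprS; congr (q ^+ _); lia.
have -> : - q ^+ 2 = t by [].
have h1 : 1 + q ^+ 2 != 0.
  by rewrite -[q ^+ 2]opprK; apply: subr1_neq0; rewrite normrN normrX exprn_ilt1.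
have h6 : qpoch (- q ^ (2 + 4)) p k != 0.
  apply: qpoch_neq0; rewrite // -[q ^ _]/(q ^+ 6) normrN normrX exprn_ilt1 //.
have hp m : qpoch p p m != 0 by exact: qpoch_neq0.
move: (hp k) (hp (n - k.*2)%N) h6 h1.
move: (qpoch p p k) (qpoch p p (n - k.*2)) (qpoch (- q ^ (2 + 4)) p k) (qpoch t p (n - k.*2)) (1 + q ^+ 2).
move: (q ^+ (n * n)) (q ^+ (2 * (n - k.*2))) (q ^+ (4 * k)) => x1 x2 x3 x4 x5 x6 x7 x8 n1 n2 n3 n4.
by field; rewrite n1 n2 n3 n4 q0.
Qed.

End Half.
End NahmSums.

(** * Conversion to the products of modulus 24 *)

Section EtaQuotients.
Variable R : realType.
Local Notation C := (R[i] : numFieldType).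
Local Notation P := (@qpoch_inf C).

(** Sorting factors by residues modulo 6: dividing J_1 by the multiples of 2 and of 3, and restoring
    the multiples of 6, leaves the residues 1 and 5. *)
Lemma jacobi_1_6 (z : C) : z != 0 -> `|z| < 1 ->
  P z (z ^+ 6) * P (z ^+ 5) (z ^+ 6) * P (z ^+ 6) (z ^+ 6) =
  P z z * P (z ^+ 6) (z ^+ 6) ^+ 2 / (P (z ^+ 2) (z ^+ 2) * P (z ^+ 3) (z ^+ 3)).
Proof.
move=> z0 z1; have [h0 h1] := @expr_punctured_disc _ z 2 isT z0 z1.
have [t0 t1] := @expr_punctured_disc _ z 3 isT z0 z1; have [k0 k1] := @expr_punctured_disc _ z 6 isT z0 z1.
have e1 := qpoch_inf_mod3 z z0 z1; have e2 := qpoch_inf_mod3 (z ^+ 2) h0 h1.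
have e3 := qpoch_inf_mod2 z t0 t1; have e4 := qpoch_inf_mod2 (z ^+ 2) t0 t1.
rewrite (_ : z * z = z ^+ 2) in e1; last by ring.
rewrite (_ : z * z ^+ 2 = z ^+ 3) in e1; last by ring.
rewrite (_ : z ^+ 2 * z ^+ 2 = z ^+ 4) in e2; last by ring.
rewrite (_ : z ^+ 2 * (z ^+ 2) ^+ 2 = z ^+ 6) in e2; last by ring.
rewrite (_ : (z ^+ 2) ^+ 3 = z ^+ 6) in e2; last by ring.
rewrite (_ : z * z ^+ 3 = z ^+ 4) in e3; last by ring.
rewrite (_ : (z ^+ 3) ^+ 2 = z ^+ 6) in e3; last by ring.
rewrite (_ : (z ^+ 3) ^+ 2 = z ^+ 6) in e4; last by ring.
rewrite (_ : z ^+ 2 * z ^+ 3 = z ^+ 5) in e4; last by ring.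
have := qpoch_inf_self_neq0 t0 t1; have := qpoch_inf_self_neq0 h0 h1.
have := qpoch_inf_self_neq0 k0 k1; rewrite e1 e2 e3 e4.
move: (P (z ^+ 2) (z ^+ 6)) (P (z ^+ 4) (z ^+ 6)) (P (z ^+ 6) (z ^+ 6)).
move: (P z (z ^+ 6)) (P (z ^+ 5) (z ^+ 6)) (P (z ^+ 3) (z ^+ 3)) => A B J3 X Y J6.
rewrite !mulf_eq0 !negb_or => n6 /andP[/andP[nX nY] _] n3.
by field; rewrite nX nY n3 n6.
Qed.

Variable q : C.
Hypotheses (q0 : q != 0) (q1 : `|q| < 1).

Lemma qJ_neq0 n : (0 < n)%N -> qJ q n != 0.
Proof. by move=> n0; have [h0 h1] := expr_punctured_disc n0 q0 q1; exact: qpoch_inf_self_neq0. Qed.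

Lemma qJ_opp n : (0 < n)%N -> P (- q ^+ n) (q ^+ n) = qJ q (n * 2) / qJ q n.
Proof.
move=> n0; have [h0 h1] := expr_punctured_disc n0 q0 q1.
by rewrite (qpoch_inf_opp h0 h1) -exprM.
Qed.

Lemma qJ_opp_odd n : (0 < n)%N ->
  P (- q ^+ n) (q ^+ (n * 2)) = qJ q (n * 2) ^+ 2 / (qJ q n * qJ q (n * 4)).
Proof.
move=> n0; have [h0 h1] := expr_punctured_disc n0 q0 q1.
by have := qpoch_inf_opp_odd h0 h1; rewrite -!exprM.
Qed.

Lemma qJpE a m : qJp q a m = P (q ^+ a) (q ^+ m) * P (q ^+ (m - a)) (q ^+ m) * qJ q m.
Proof. by rewrite /qJp /qpochs_inf !big_cons big_nil mulr1 mulrA. Qed.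

Lemma qJp_4_24 : qJp q 4 24 = qJ q 4 * qJ q 24 ^+ 2 / (qJ q 8 * qJ q 12).
Proof.
have [h0 h1] := @expr_punctured_disc _ q 4 isT q0 q1; have := jacobi_1_6 h0 h1.
by rewrite -!exprM qJpE.
Qed.

Lemma qJp_6_24 : qJp q 6 24 = qJ q 6 * qJ q 24 / qJ q 12.
Proof.
have [h0 h1] := @expr_punctured_disc _ q 6 isT q0 q1; have [k0 k1] := @expr_punctured_disc _ q 12 isT q0 q1.
have e1 := qpoch_inf_odd h0 h1; have e2 := qpoch_inf_mod2 (q ^+ 6) k0 k1.
rewrite -exprM -[(6 * 2)%N]/12%N in e1; rewrite e1 -exprM -exprD in e2.
by rewrite qJpE -[(24 - 6)%N]/(6 + 12)%N -[24%N]/(12 * 2)%N -e2 mulrAC.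
Qed.

(** (q^a; q^12)_inf splits into the residues a and a + 12 modulo 24, and a + 12 = 24 - (12 - a). *)
Lemma qJp_double a : (a <= 12)%N ->
  qJp q a 24 * qJp q (12 - a) 24 = theta12 q a * qJ q 24 ^+ 2 / qJ q 12.
Proof.
move=> a12; have [k0 k1] := @expr_punctured_disc _ q 12 isT q0 q1.
have e1 := qpoch_inf_mod2 (q ^+ a) k0 k1; have e2 := qpoch_inf_mod2 (q ^+ (12 - a)) k0 k1.
rewrite -exprM -exprD -[(12 * 2)%N]/24%N in e1; rewrite -exprM -exprD -[(12 * 2)%N]/24%N in e2.
rewrite !qJpE /theta12 e1 e2 (_ : 24 - a = 12 - a + 12)%N; last by lia.
rewrite (_ : 24 - (12 - a) = a + 12)%N; last by lia.
have := qJ_neq0 (isT : 0 < 12)%N; rewrite /qJ.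
move: (P (q ^+ 12) (q ^+ 12)) (P (q ^+ 24) (q ^+ 24)) (P (q ^+ a) (q ^+ 24)).
move: (P (q ^+ (12 - a)) (q ^+ 24)) (P (q ^+ (a + 12)) (q ^+ 24)) (P (q ^+ (12 - a + 12)) (q ^+ 24)).
by move=> x1 x2 x3 x4 x5 x6 n; field.
Qed.

Lemma has_sum_half_sum_difference (f g : int -> C) (X S T : C) :
  has_sum f (X * (S + T)) -> has_sum g (X * (S - T)) ->
  has_sum (fun d => (f d + 1 * g d) / 2) (X * S) /\
  has_sum (fun d => (f d + -1 * g d) / 2) (X * T).
Proof.
move=> hf hg; have two : (2 : C) != 0 by rewrite pnatr_eq0.
split; [have := has_sumZ 2^-1 (has_sumD hf (has_sumZ 1 hg))
  | have := has_sumZ 2^-1 (has_sumD hf (has_sumZ (-1) hg))].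
  rewrite [X in has_sum _ X -> _](_ : _ = X * S); last by field.
  by apply: eq_has_sum => d; rewrite mulrC.
rewrite [X in has_sum _ X -> _](_ : _ = X * T); last by field.
by apply: eq_has_sum => d; rewrite mulrC.
Qed.

Lemma phi3_sum : has_sum (fun d : int => q ^ (2 * (d * d)) * q ^ (d * d))
  (P (- q ^+ 3) (q ^+ 6) ^+ 2 * P (q ^+ 6) (q ^+ 6)).
Proof.
have [t0 t1] := @expr_punctured_disc _ q 3 isT q0 q1.
have := phi_sum t0 t1; rewrite -exprM -[(3 * 2)%N]/6%N.
apply: eq_has_sum => d; rewrite -[q ^+ 3]/(q ^ 3) exprz_exp -expfzDr //.
by congr (q ^ _); ring.
Qed.

(** phi(q) = X (S + T) and phi(q^3) = X (S - T) with X = (- q; q^2)_inf, S = J_(5,12), T = q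
    J_(1,12). *)
Lemma half_theta :
  has_sum (fun d : int => (q ^ (d * d) + 1 * (q ^ (2 * (d * d)) * q ^ (d * d))) / 2)
    (P (- q) (q ^+ 2) * theta12 q 5) /\
  has_sum (fun d : int => (q ^ (d * d) + -1 * (q ^ (2 * (d * d)) * q ^ (d * d))) / 2)
    (P (- q) (q ^+ 2) * (q * theta12 q 1)).
Proof.
have h1 := phi_sum q0 q1; rewrite (phi_theta12 q0 q1) in h1.
have h2 := phi3_sum; rewrite (phi3_theta12 q0 q1) in h2.
exact: has_sum_half_sum_difference h1 h2.
Qed.

Lemma half_theta_plus :
  has_sum (fun d : int => (1 + 1 * q ^ (2 * (d * d))) / 2 * q ^ (d * d))
    (P (- q) (q ^+ 2) * theta12 q 5).
Proof.
apply: eq_has_sum half_theta.1 => d.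
by move: (q ^ _) (q ^ _) => x y; field.
Qed.

Lemma half_theta_minus :
  has_sum (fun d : int => (1 + -1 * q ^ (2 * (d * d))) / 2 * q ^ (d * d))
    (P (- q) (q ^+ 2) * (q * theta12 q 1)).
Proof.
apply: eq_has_sum half_theta.2 => d.
by move: (q ^ _) (q ^ _) => x y; field.
Qed.

End EtaQuotients.

Theorem theorem3p2 (R : realType) (q : R[i]) (hq : 0 < `|q| < 1) :
  [/\ nahm_sum_is q (-2) 0 4
        (2 * q^-1 * (qJ q 2 ^+ 5 * qJ q 8 ^+ 2)
         / (qJ q 1 ^+ 2 * qJ q 4 ^+ 5)),
      nahm_sum_is q 0 (-1) 2
        (2 * (qJ q 4 ^+ 2 / qJ q 2 ^+ 2)),
      nahm_sum_is q (-2) 2 4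
        (2 * (qJ q 2 ^+ 2 * qJ q 3 * qJ q 24 ^+ 4)
         / (qJ q 1 * qJ q 4 ^+ 2 * qJ q 6 * qJ q 12 * qJp q 4 24 ^+ 2)),
      nahm_sum_is q 2 0 0
        (qJ q 6 ^+ 2 * qJp q 6 24 ^+ 3 * qJ q 24
         / (qJ q 3 ^+ 2 * qJ q 4 * qJ q 12 * qJp q 4 24 ^+ 2)) &
    [/\ nahm_sum_is q 0 0 0
          (qJ q 12 ^+ 3 * qJp q 4 24 ^+ 2 * qJp q 5 24 * qJp q 7 24
           / (qJ q 1 * qJ q 24 ^+ 6)),
        nahm_sum_is q 0 2 4
          (qJ q 12 ^+ 3 * qJp q 1 24 * qJp q 11 24 * qJp q 4 24 ^+ 2
           / (qJ q 1 * qJ q 24 ^+ 6)) &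
        nahm_sum_is q 2 (-2) 0
          (qJ q 2 ^+ 5 * qJ q 8 ^+ 2 / (qJ q 1 ^+ 2 * qJ q 4 ^+ 5))]].
Proof.
have [q0 q1] : q != 0 /\ `|q| < 1 by case/andP: hq; rewrite normr_gt0.
pose C := R[i] : numFieldType.
have nJ n (n0 : (0 < n)%N) : qJ (q : C) n != 0 by exact: qJ_neq0.
have o4 : qpoch_inf (- q ^+ 4) (q ^+ 4) = qJ q 8 / qJ q 4 by exact: (@qJ_opp _ q q0 q1 4 isT).
have [p0 p1] := @expr_punctured_disc _ q 4 isT q0 q1.
have o41 : qpoch_inf (-1) (q ^+ 4) = 2 * (qJ q 8 / qJ q 4) by rewrite qpoch_inf_opp1 // o4.
have o2 : qpoch_inf (- q ^+ 2) (q ^+ 4) = qJ q 4 ^+ 2 / (qJ q 2 * qJ q 8).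
  exact: (@qJ_opp_odd _ q q0 q1 2 isT).
have o1 : qpoch_inf (- q) (q ^+ 2) = qJ q 2 ^+ 2 / (qJ q 1 * qJ q 4).
  exact: (@qJ_opp_odd _ q q0 q1 1 isT).
have o3 : qpoch_inf (- q ^+ 3) (q ^+ 6) = qJ q 6 ^+ 2 / (qJ q 3 * qJ q 12).
  exact: (@qJ_opp_odd _ q q0 q1 3 isT).
have phi := phi_sum q0 q1; rewrite o1 -/(qJ q 2) in phi.
have phi' := shifted_phi_sum q0 q1; rewrite o1 -/(qJ q 2) in phi'.
have psi := psi_sum q0 q1; rewrite -/(qJ q 2) -/(qJ q 4) in psi.
have [t0 t1] := @expr_punctured_disc _ q 3 isT q0 q1.
have e24 := qJp_4_24 q0 q1.
have n1 := nJ 1%N isT; have n2 := nJ 2%N isT; have n3 := nJ 3%N isT; have n4 := nJ 4%N isT.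
have n6 := nJ 6%N isT; have n8 := nJ 8%N isT; have n12 := nJ 12%N isT; have n24 := nJ 24%N isT.
have s1 := nahm_sum_m204 q0 q1 phi'; have s2 := nahm_sum_0m12 q0 q1 psi.
have t13 : has_sum (fun d : int => q ^ (2 * (d * d) - 2 * d) * q ^ (d * d))
  (qJ q 2 ^+ 2 * qJ q 3 * qJ q 12 / (qJ q 1 * qJ q 4 * qJ q 6)) := theta13_sum q0 q1.
have s3 := nahm_sum_m224 q0 q1 t13.
have phi3 : has_sum (fun d : int => q ^ (2 * (d * d)) * q ^ (d * d))
    ((qJ q 6 ^+ 2 / (qJ q 3 * qJ q 12)) ^+ 2 * qJ q 6).
  by have := phi3_sum q0 q1; rewrite o3 -/(qJ q 6).
have s4 := nahm_sum_200 q0 q1 phi3.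
have s7 := nahm_sum_2m20 q0 q1 phi.
have [s5 s6] := (nahm_sum_000 q0 q1 (half_theta_plus q0 q1), nahm_sum_024 q0 q1 (half_theta_minus q0 q1)).
rewrite o1 in s5; rewrite o1 in s6.
have d5 := qJp_double q0 q1 (isT : 5 <= 12)%N; have d1 := qJp_double q0 q1 (isT : 1 <= 12)%N.
rewrite -[(12 - 5)%N]/7%N in d5; rewrite -[(12 - 1)%N]/11%N in d1.
(* The closed forms contain J_(5,24) J_(7,24) and J_(1,24) J_(11,24), so [theta12] is rewritten
   through these products. *)
have th (a : nat) (X Y : C) : X * Y = theta12 q a * qJ q 24 ^+ 2 / qJ q 12 ->
    theta12 q a = X * Y * qJ q 12 / qJ q 24 ^+ 2.
  move=> ->; move: (qJ q 12) (qJ q 24) (theta12 q a) n12 n24 => x y z x0 y0.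
  by field; rewrite x0 y0.
have th5 := th _ _ _ (qJp_double q0 q1 (isT : 5 <= 12)%N).
have th1 := th _ _ _ (qJp_double q0 q1 (isT : 1 <= 12)%N).
rewrite -[(12 - 5)%N]/7%N in th5; rewrite -[(12 - 1)%N]/11%N in th1.
have eqs b1 b2 b3 (l m : C) : nahm_sum_is q b1 b2 b3 l -> l = m -> nahm_sum_is q b1 b2 b3 m.
  by move=> h <-.
rewrite o4 o41 -/(qJ q 4) in s1; rewrite o4 o2 -/(qJ q 4) in s2.
rewrite o4 o41 -/(qJ q 4) in s3; rewrite o4 -/(qJ q 4) in s4.
rewrite o2 -/(qJ q 4) in s5; rewrite o2 -/(qJ q 4) in s6; rewrite o4 -/(qJ q 4) in s7.
split; [apply: eqs s1 _|apply: eqs s2 _|apply: eqs s3 _|apply: eqs s4 _|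
  split; [apply: eqs s5 _|apply: eqs s6 _|apply: eqs s7 _]].
(* What remains are identities of rational functions in q and eight J's, with two further products
   kept as unknowns in the fifth and sixth. *)
all: rewrite ?th5 ?th1 ?(qJp_6_24 q0 q1) ?e24; move: n1 n2 n3 n4 n6 n8 n12 n24; clear -q0.
all: move: (qJ q 1) (qJ q 2) (qJ q 3) (qJ q 4) (qJ q 6) (qJ q 8) (qJ q 12) (qJ q 24).
all: move=> J1 J2 J3 J4 J6 J8 J12 J24 n1 n2 n3 n4 n6 n8 n12 n24.
5,6: move: (qJp q _ _) (qJp q _ _) => X Y.
all: by field; rewrite ?q0 ?n1 ?n2 ?n3 ?n4 ?n6 ?n8 ?n12 ?n24.
Qed.
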